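(* Let $m\ge2$ and let $\alpha\le1$. Any convex body $\Omega$ in $\mathbb{R}^m$ with a piecewise $C^1$ boundary has a unique $r^{\alpha-m}$-center, and it lies in the interior of $\Omega$.
   Context: A body is a compact subset of $\mathbb{R}^m$ that is the closure of its interior. $\mu$ is Lebesgue measure on $\mathbb{R}^m$, $B_\varepsilon(x)$ is the ball with center $x$ and radius $\varepsilon$, and $A(S^{m-1})=2\pi^{m/2}/\Gamma(m/2)$. The (renormalized) potential $V^{(\alpha)}_\Omega$ ($\alpha\in\mathbb{R}$) is defined as follows. (i) If $\alpha\le 0$ and $x\in\operatorname{int}\Omega$: for $\alpha<0$, $$V^{(\alpha)}_\Omega(x)=\lim_{\varepsilon\to+0}\left(\int_{\Omega\setminus B_\varepsilon(x)}|x-y|^{\alpha-m}\,d\mu(y)-\frac{A(S^{m-1})}{-\alpha}\cdot\frac1{\varepsilon^{-\alpha}}\right),$$ and for $\alpha=0$, $$V^{(0)}_\Omega(x)=\lim_{\varepsilon\to+0}\left(\int_{\Omega\setminus B_\varepsilon(x)}|x-y|^{-m}\,d\mu(y)-A(S^{m-1})\log\frac1\varepsilon\right).$$ (ii) If $\alpha>0$ or $x\notin\Omega$: $V^{(\alpha)}_\Omega(x)=\int_{\Omega}|x-y|^{\alpha-m}\,d\mu(y)$. For $0<\alpha<m$ an $r^{\alpha-m}$-center of $\Omega$ is a point at which the maximum value of $V_\Omega^{(\alpha)}$ on $\mathbb{R}^m$ is attained; for $\alpha\le0$ it is a point of $\operatorname{int}\Omega$ at which the maximum value of the restriction of $V_\Omega^{(\alpha)}$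 to $\operatorname{int}\Omega$ is attained. *)

(* Defs.v *)
From HB Require Import structures.
From mathcomp Require Import all_boot all_order all_algebra.
From mathcomp Require Import all_classical all_reals all_analysis.

Set Implicit Arguments.
Unset Strict Implicit.
Unset Printing Implicit Defensive.
Import Order.TTheory GRing.Theory Num.Theory.
Import numFieldNormedType.Exports.

Local Open Scope classical_set_scope.
Local Open Scope ring_scope.

(* R^n is 'rV[R]_n. Its library topology is that of the sup norm, i.e. the
   usual one; Euclidean distances use [enorm] below. *)

(* R^n carries the product sigma-algebra of the Borel sets of R, generated by
   the coordinates (this is also the Borel sigma-algebra of R^n). *)
Definition rV_display : measure_display.
Proof. exact: default_measure_display. Qed.

Definition rV_coord (R : realType) (n : nat) (i : 'I_n) (x : 'rV[R]_n) :
  measurableTypeR R := x ord0 i.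

Section measurable_rV.
Variables (R : realType) (n : nat).

Let rV_set0 : g_sigma_preimage (@rV_coord R n) set0.
Proof. exact: sigma_algebra0. Qed.

Let rV_setC A :
  g_sigma_preimage (@rV_coord R n) A -> g_sigma_preimage (@rV_coord R n) (~` A).
Proof. exact: sigma_algebraC. Qed.

Let rV_bigcup (F : _^nat) : (forall i, g_sigma_preimage (@rV_coord R n) (F i)) ->
  g_sigma_preimage (@rV_coord R n) (\bigcup_i (F i)).
Proof. exact: sigma_algebra_bigcup. Qed.

HB.instance Definition _ := @isMeasurable.Build rV_display
  'rV[R]_n (g_sigma_preimage (@rV_coord R n)) rV_set0 rV_setC rV_bigcup.

End measurable_rV.

Definition rV_cons (R : realType) (n : nat) (p : measurableTypeR R * 'rV[R]_n) :
  'rV[R]_n.+1 := row_mx (p.1 : R)%:M p.2 : 'rV[R]_(1 + n).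

(* Lebesgue measure on R^n: unit mass at the only point of R^0, and the product
   of the Lebesgue measures of R and R^n on R^(n+1). *)
Fixpoint lebesgue_rV (R : realType) (n : nat) : set 'rV[R]_n -> \bar R :=
  match n return set 'rV[R]_n -> \bar R with
  | 0%N => dirac (0 : 'rV[R]_0)
  | n'.+1 => pushforward
      ((@lebesgue_measure R : set (measurableTypeR R) -> \bar R) \x
       @lebesgue_rV R n')%E
      (@rV_cons R n')
  end.

Section lebesgue_rV_measure.
Variable R : realType.

Lemma measurable_rV_coord n (i : 'I_n) :
  measurable_fun [set: 'rV[R]_n] (rV_coord i).
Proof.
move=> _ Y mY; rewrite setTI; apply: sub_sigma_algebra => /=.
case: n i => [|n] i; first by case: i.
rewrite -bigcup_mkord_ord; exists i => //=.
by exists Y => //; rewrite setTI inord_val.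
Qed.

Lemma measurable_rV_cons n : measurable_fun setT (@rV_cons R n).
Proof.
move=> _ Y; rewrite setTI.
have h : <<s \big[setU/set0]_(i < n.+1)
    preimage_set_system setT (@rV_coord R n.+1 i) measurable >> `<=`
    [set A | measurable (@rV_cons R n @^-1` A)].
  apply: smallest_sub.
    split=> /=.
    - by rewrite preimage_set0.
    - by move=> A mA; rewrite setTD preimage_setC; exact: measurableC.
    - by move=> F mF; rewrite preimage_bigcup; exact: bigcupT_measurable.
  rewrite -bigcup_mkord_ord; apply: bigcup_sub => i Ii A [B mB <-{A}] /=.
  rewrite setTI -comp_preimage.
  suff mi : measurable_fun setT (rV_coord (inord i) \o @rV_cons R n).
    by rewrite -[X in measurable X]setTI; exact: mi.
  move: (inord i : 'I_n.+1) => j.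
  have := splitK (j : 'I_(1 + n)); case: (fintype.split _) => k /= <-.
    rewrite (_ : _ \o _ = fst); first exact: measurable_fst.
    apply/funext => p; rewrite /rV_coord/= /rV_cons.
    by rewrite (@row_mxEl _ 1 1 n) mxE !ord1.
  rewrite (_ : _ \o _ = rV_coord k \o snd).
    exact: measurableT_comp (measurable_rV_coord k) measurable_snd.
  by apply/funext => p; rewrite /rV_coord/= /rV_cons (@row_mxEr _ 1 1 n).
exact: h.
Qed.

Lemma rV_cons_bij n : bijective (@rV_cons R n).
Proof.
exists (fun x : 'rV[R]_(1 + n) => (x ord0 (lshift n ord0), rsubmx x)).
  by case=> a x; rewrite /rV_cons (@row_mxEl _ 1 1 n) (@row_mxKr _ 1 1 n) mxE eqxx mulr1n.
move=> x; rewrite /rV_cons/= -[RHS](@hsubmxK _ 1 1 n); congr row_mx.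
by apply/matrixP => i j; rewrite !ord1 !mxE.
Qed.

Lemma measurable_rV_cons_image n (A : set (measurableTypeR R * 'rV[R]_n)) :
  measurable A -> measurable (@rV_cons R n @` A).
Proof.
pose g := fun x : 'rV[R]_n.+1 =>
  (rV_coord ord0 x, rsubmx (x : 'rV[R]_(1 + n))).
have gK : cancel (@rV_cons R n) g.
  case=> a x; rewrite /g /rV_coord /rV_cons row_mxKr; congr pair.
  by rewrite (_ : ord0 = lshift n (ord0 : 'I_1)) ?(@row_mxEl _ 1 1 n) ?mxE ?eqxx ?mulr1n//; exact/val_inj.
have Kg : cancel g (@rV_cons R n).
  have [h /[dup] hK _ Kh] := rV_cons_bij n.
  by move=> x; rewrite -(Kh x) gK.
have mg : measurable_fun setT g.
  apply: measurable_fun_pair; first exact: measurable_rV_coord.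
  move=> _ Y; rewrite setTI.
  have h : <<s \big[setU/set0]_(i < n)
      preimage_set_system setT (@rV_coord R n i) measurable >> `<=`
      [set A | measurable ((fun x : 'rV[R]_n.+1 =>
         rsubmx (x : 'rV[R]_(1 + n))) @^-1` A)].
    apply: smallest_sub.
      split=> /=.
      - by rewrite preimage_set0.
      - by move=> B mB; rewrite setTD preimage_setC; exact: measurableC.
      - by move=> F mF; rewrite preimage_bigcup; exact: bigcupT_measurable.
    move=> B; rewrite -bigcup_seq => -[/= i _] [C mC <-] /=.
    rewrite setTI -comp_preimage.
    rewrite (_ : _ \o _ = rV_coord (rshift 1 i : 'I_n.+1)).
      by rewrite -[X in measurable X]setTI; exact: measurable_rV_coord.
    by apply/funext => x; rewrite /rV_coord/= mxE.
  exact: h.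
move=> mA; rewrite (_ : _ @` A = g @^-1` A).
  by rewrite -[X in measurable X]setTI; exact: mg.
apply/seteqP; split=> [_ [p Ap <-]|x Ax] /=; first by rewrite gK.
by exists (g x).
Qed.

Section step.
Variables (n : nat) (mu : {sigma_finite_measure set 'rV[R]_n -> \bar R}).

Definition lebesgue_rV_step : set 'rV[R]_n.+1 -> \bar R := pushforward
  ((@lebesgue_measure R : set (measurableTypeR R) -> \bar R) \x mu)%E
  (@rV_cons R n).

Let step0 : lebesgue_rV_step set0 = 0%E.
Proof. by rewrite /lebesgue_rV_step /pushforward preimage_set0 measure0. Qed.

Let step_ge0 A : (0 <= lebesgue_rV_step A)%E.
Proof. by rewrite /lebesgue_rV_step /pushforward measure_ge0. Qed.

Let step_sigma_additive : semi_sigma_additive lebesgue_rV_step.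
Proof.
move=> F mF tF mUF; rewrite /lebesgue_rV_step /pushforward preimage_bigcup.
apply: measure_semi_sigma_additive.
- by move=> i; rewrite -[X in measurable X]setTI; exact: measurable_rV_cons.
- apply/trivIsetP => /= i j _ _ ij; rewrite -preimage_setI.
  by move/trivIsetP : tF => /(_ _ _ _ _ ij) ->//; rewrite preimage_set0.
- rewrite -preimage_bigcup -[X in measurable X]setTI.
  exact: measurable_rV_cons.
Qed.

HB.instance Definition _ := isMeasure.Build _ _ _ lebesgue_rV_step
  step0 step_ge0 step_sigma_additive.

Let step_sigma_finite : sigma_finite setT lebesgue_rV_step.
Proof.
have /sigma_finiteP[F [TF ndF Foo]] := sigma_finiteT (@lebesgue_measure R).
have /sigma_finiteP[G [TG ndG Goo]] := sigma_finiteT mu.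
exists (fun k => @rV_cons R n @` (F k `*` G k)).
  apply/esym/seteqP; split=> // x _; have [h _ Kh] := rV_cons_bij n.
  have [[k _ Fk] [l _ Gl]] : (\bigcup_k F k) (h x).1 /\ (\bigcup_k G k) (h x).2.
    by rewrite -TF -TG.
  exists (maxn k l) => //; exists (h x) => //; split.
  - by move: Fk; exact/subsetPset/ndF/leq_maxl.
  - by move: Gl; exact/subsetPset/ndG/leq_maxr.
move=> k; have [mF Flt] := Foo k; have [mG Glt] := Goo k; split.
  by apply: measurable_rV_cons_image; exact: measurableX.
rewrite /lebesgue_rV_step /pushforward.
rewrite (_ : _ @^-1` _ = F k `*` G k); last first.
  apply/seteqP; split=> [p [q Fq /(bij_inj (@rV_cons_bij n)) <-]//|p Fp].
  by exists p.
by rewrite product_measure1E// lte_mul_pinfty// ge0_fin_numE.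
Qed.

HB.instance Definition _ :=
  @Measure_isSigmaFinite.Build _ _ _ lebesgue_rV_step step_sigma_finite.

End step.

Let lebesgue_rV_ex n :
  {mu : {sigma_finite_measure set 'rV[R]_n -> \bar R} |
    @lebesgue_rV R n = mu :> (set 'rV[R]_n -> \bar R)}.
Proof.
elim: n => [|n [mu muE]]; first by exists (dirac (0 : 'rV[R]_0)).
by exists (lebesgue_rV_step mu); rewrite /= muE.
Qed.

Variable n : nat.

Let lebesgue_rV0 : @lebesgue_rV R n set0 = 0%E.
Proof. by have [mu ->] := lebesgue_rV_ex n. Qed.

Let lebesgue_rV_ge0 A : (0 <= @lebesgue_rV R n A)%E.
Proof. by have [mu ->] := lebesgue_rV_ex n. Qed.

Let lebesgue_rV_sigma_additive : semi_sigma_additive (@lebesgue_rV R n).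
Proof.
by have [mu ->] := lebesgue_rV_ex n; exact: measure_semi_sigma_additive.
Qed.

HB.instance Definition _ := isMeasure.Build _ _ _ (@lebesgue_rV R n)
  lebesgue_rV0 lebesgue_rV_ge0 lebesgue_rV_sigma_additive.

Let lebesgue_rV_sigma_finite : sigma_finite setT (@lebesgue_rV R n).
Proof. by have [mu ->] := lebesgue_rV_ex n; exact: sigma_finiteT. Qed.

HB.instance Definition _ := @Measure_isSigmaFinite.Build _ _ _
  (@lebesgue_rV R n) lebesgue_rV_sigma_finite.

End lebesgue_rV_measure.

Section body.
Variables (R : realType) (n : nat).
Implicit Types (Omega : set 'rV[R]_n).

Definition body Omega := compact Omega /\ Omega = closure (interior Omega).

(* Nonemptiness, tacit in the literature, is not implied by [body]. *)
Definition convex_body Omega :=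
  [/\ Omega !=set0, body Omega & convex_set Omega].

(* [phi] is a C^1 embedding of the compact set [D] up to its boundary: it is
   C^1 near [D], injective on [D], and its differential is injective at the
   points of [D]. *)
Definition C1_embedding (p : nat) (phi : 'rV[R]_n -> 'rV[R]_p) (D : set 'rV[R]_n) :=
  exists U : set 'rV[R]_n,
    [/\ open U, D `<=` U,
        forall u, U u -> differentiable phi u /\ {for u, continuous (jacobian phi)},
        set_inj D phi &
        forall u, D u -> row_free (jacobian phi u)].

End body.

(* The boundary of a body of R^(n+1) is piecewise C^1 when it is a finite union
   of C^1 hypersurface pieces which overlap at most along their edges, each
   piece being parametrized by a body of R^n whose own boundary is, recursively,
   piecewise C^1. For n = 1 these are finitely many regular C^1 arcs. *)
Fixpoint piecewise_C1_boundary (R : realType) (n : nat) :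
    set 'rV[R]_n -> Prop :=
  match n return set 'rV[R]_n -> Prop with
  | 0%N => fun=> True
  | n'.+1 => fun Omega =>
    exists (k : nat) (D : 'I_k -> set 'rV[R]_n')
        (phi : 'I_k -> 'rV[R]_n' -> 'rV[R]_n'.+1),
      [/\ forall i, body (D i) /\ piecewise_C1_boundary (D i),
          forall i, C1_embedding (phi i) (D i),
          forall i j, i != j ->
            (phi i @` interior (D i)) `&` (phi j @` D j) = set0 &
          closure Omega `\` interior Omega = \bigcup_i (phi i @` D i)]
  end.

Definition Gamma (R : realType) (s : R) : R :=
  \int[lebesgue_measure]_(t in `]0, +oo[) (t `^ (s - 1) * expR (- t)).

(* the area A(S^(m-1)) of the unit sphere of R^m *)
Definition sphere_area (R : realType) (m : nat) : R :=
  2 * pi `^ (m%:R / 2) / Gamma (m%:R / 2).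

Section potential.
Variables (R : realType) (m : nat).
Implicit Types (Omega : set 'rV[R]_m) (alpha : R) (x y : 'rV[R]_m).

Definition enorm x : R := Num.sqrt (\sum_(i < m) x ord0 i ^+ 2).

Definition eball x (eps : R) : set 'rV[R]_m := [set y | enorm (x - y) < eps].

(* The integral over [A] of |x - y|^(alpha - m). The totalization 0 `^ a = 0 for
   a != 0 only affects the null set {x}. *)
Definition riesz_integral alpha (A : set 'rV[R]_m) x : \bar R :=
  (\int[@lebesgue_rV R m]_(y in A) (enorm (x - y) `^ (alpha - m%:R))%:E)%E.

Definition counterterm alpha (eps : R) : R :=
  if alpha == 0 then sphere_area R m * ln (1 / eps)
  else sphere_area R m / (- alpha) * (1 / eps `^ (- alpha)).

(* Values are in \bar R so that no integral is totalized; they are finite in the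
   cases that matter. For alpha <= 0 the potential is not defined on the boundary
   of [Omega]; the value given there by the second branch is never used. *)
Definition potential alpha Omega x : \bar R :=
  if (alpha <= 0) && `[< interior Omega x >] then
    lim ((riesz_integral alpha (Omega `\` eball x eps) x
          - (counterterm alpha eps)%:E)%E @[eps --> 0^'+])
  else riesz_integral alpha Omega x.

(* [x] is an r^(alpha-m)-center of [Omega] (a notion defined for alpha < m). *)
Definition is_center alpha Omega x : Prop :=
  if alpha <= 0 then
    interior Omega x /\
    forall y, interior Omega y ->
      (potential alpha Omega y <= potential alpha Omega x)%E
  else
    alpha < m%:R /\
    forall y, (potential alpha Omega y <= potential alpha Omega x)%E.

End potential.

(* Main.v *)
Require Import Defs.
From mathcomp Require Import all_boot all_order all_algebra.
From mathcomp Require Import all_classical all_reals all_analysis.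
From mathcomp Require Import measurable_realfun ring lra.
Import Order.TTheory GRing.Theory Num.Theory.
Import numFieldNormedType.Exports.
Local Open Scope classical_set_scope.
Local Open Scope ring_scope.

(** Let [B_D(x)] be the ball of center [x] whose radius [D] exceeds the diameter of
    [Omega], and let [F(x)] be the integral of [|x - y|^(alpha - m)] over [B_D(x)] minus
    [Omega], the [deficit] of [Omega] at [x]. Polar coordinates evaluate the integral of
    the kernel over the shell [e <= |x - y| < D]; for [alpha <= 0] the counterterm of the
    renormalization is exactly the part of it that diverges as [e] tends to 0. Therefore
    [V = c - F] with a constant [c], at the interior points of [Omega] and, for
    [alpha > 0], at all its points ([deficit_interior], [deficit_pos]). The centers are
    the minimisers of [F], a function with values in [[0, +oo]].

    Strict convexity ([deficit_strict]). In polar coordinates [F(x)] is the integral over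
    the directions [u] of [P(D) - P(rho(x, u))], where [rho(x, u)] is the time at which
    the ray from [x] in the direction [u] leaves [Omega], and [P] is a primitive of
    [s^(alpha - 1)]. As [Omega] is convex, [rho] is concave in [x]; as [alpha <= 1], [P]
    is increasing and concave. So [F] is midpoint convex on the interior, and it is
    strictly so because, for any two distinct points, [rho] is strictly concave between
    them in some direction ([strict_chord]) and then in an open set of directions. Hence
    there is at most one interior minimiser.

    Boundary points ([deficit_boundary]). Let [p] be a boundary point with [F(p)] finite
    and move it inwards by [t]. The part of the ball that is lost lies away from [p] and
    costs [O(t)]. The part that is gained has, at every distance [r] between [t] and a
    constant, a measure of order at least [t r^(m - 1)], where the kernel is at least
    [r^(1 - m)]; the dyadic scales contribute [t] each, and there are about [log(1 / t)]
    of them. So the gain prevails and [p] does not minimise [F].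

    Existence. By Fatou's lemma [F] is lower semicontinuous ([deficit_lsc]), so it has a
    minimum on the compact set [Omega], which is attained in the interior. For
    [alpha > 0] points outside [Omega] compete as well, but the nearest point of [Omega]
    is closer to every point of [Omega] and its potential is at least as large
    ([projection], [riesz_projection]).

    Integration over directions is carried out on the shell [1 < |u| < e] in place of
    the sphere ([polar]). That its total mass is [2 pi^(m/2) / Gamma(m/2)] follows from
    the Gaussian integral ([sphere_massE]). *)

(** * Affine changes of variables for Lebesgue measure *)

Section affine.
Context {R : realType}.
Local Open Scope ereal_scope.
Local Notation lambda := (@lebesgue_measure R).

Lemma measurable_affine (s b : R) :
  measurable_fun [set: measurableTypeR R]
    ((fun x => s * x + b)%R : measurableTypeR R -> measurableTypeR R).
Proof.
by apply: measurable_funD => //; exact: measurable_funM.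
Qed.

(** Lebesgue measure and [s] times its image under the affine map agree on half-open
    intervals, hence everywhere. *)
Lemma ge0_integral_affine (s b : R) (f : R -> \bar R) : (0 < s)%R ->
  measurable_fun [set: measurableTypeR R] f -> (forall x, 0 <= f x) ->
  \int[lambda]_x f x = s%:E * \int[lambda]_x f (s * x + b)%R.
Proof.
move=> s0 mf f0.
pose phi : measurableTypeR R -> measurableTypeR R := (fun x => s * x + b)%R.
have mphi : measurable_fun setT phi by exact: measurable_affine.
have key A : measurable A -> lambda A =
    mscale (NngNum (ltW s0)) (pushforward lambda phi) A.
  apply: lebesgue_measure_unique => _ [[x y]] _ <-.
  rewrite -[RHS]/(s%:E * lambda (phi @^-1` `]x, y])).
  rewrite (_ : phi @^-1` _ = `](x - b) / s, (y - b) / s]%classic)%R; last first.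
    apply/seteqP; split=> t /=; rewrite !in_itv/= /phi.
      move=> /andP[h1 h2]; apply/andP; split.
        by rewrite ltr_pdivrMr// mulrC ltrBlDr.
      by rewrite ler_pdivlMr// mulrC lerBrDr.
    move=> /andP[]; rewrite ltr_pdivrMr// ler_pdivlMr// mulrC ltrBlDr lerBrDr.
    by move=> -> ->.
  rewrite !lebesgue_measure_itv/= !lte_fin ltr_pM2r ?invr_gt0// ltrD2r.
  case: ifPn => _; last by rewrite mule0.
  by rewrite -!EFinB -EFinM; congr EFin; field; rewrite gt_eqF.
rewrite (eq_measure_integral (mscale (NngNum (ltW s0)) (pushforward lambda phi))); last first.
  by move=> A mA _; exact: key.
rewrite ge0_integral_mscale//=; congr *%E.
by rewrite ge0_integral_pushforward.
Qed.

Lemma ge0_integral_rVS n (f : 'rV[R]_n.+1 -> \bar R) :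
  measurable_fun setT f -> (forall x, 0 <= f x) ->
  \int[@lebesgue_rV R n.+1]_z f z =
  \int[lambda]_a \int[@lebesgue_rV R n]_v f (rV_cons (a, v)).
Proof.
move=> mf f0.
transitivity (\int[lambda \x @lebesgue_rV R n]_p f (rV_cons p)).
  exact: (ge0_integral_pushforward (@measurable_rV_cons R n)
    (lambda \x @lebesgue_rV R n) measurableT mf (fun x _ => f0 x)).
rewrite (fubini_tonelli1 (f \o @rV_cons R n))//.
  exact: measurableT_comp mf (@measurable_rV_cons R n).
by move=> p; exact: f0.
Qed.

Lemma measurable_fun_rV d (T : measurableType d) n (g : T -> 'rV[R]_n) :
  (forall i, measurable_fun setT (fun t => g t ord0 i : measurableTypeR R)) ->
  measurable_fun setT g.
Proof.
move=> mg _ Y; rewrite setTI.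
have h : <<s \big[setU/set0]_(i < n)
    preimage_set_system setT (@rV_coord R n i) measurable >> `<=`
    [set A | measurable (g @^-1` A)].
  apply: smallest_sub.
    split=> /=.
    - by rewrite preimage_set0.
    - by move=> B mB; rewrite setTD preimage_setC; exact: measurableC.
    - by move=> F mF; rewrite preimage_bigcup; exact: bigcupT_measurable.
  move=> B; rewrite -bigcup_seq => -[/= i _] [C mC <-] /=.
  rewrite setTI -comp_preimage.
  by rewrite -[X in measurable X]setTI; exact: mg.
exact: h.
Qed.

Lemma measurable_coord n (i : 'I_n) :
  measurable_fun setT (fun x : 'rV[R]_n => x ord0 i : measurableTypeR R).
Proof. exact: measurable_rV_coord. Qed.

Lemma measurable_affine_rV n (s : R) (b : 'rV[R]_n) :
  measurable_fun setT (fun z : 'rV[R]_n => (s *: z + b)%R).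
Proof.
apply: measurable_fun_rV => i.
under eq_fun do rewrite !mxE.
apply: measurable_funD => //.
by apply: measurable_funM => //; exact: measurable_coord.
Qed.

Lemma rV_consE n (a : R) (v : 'rV[R]_n) (i : 'I_n.+1) :
  rV_cons (a, v) ord0 i = if unlift ord0 i is Some j then v ord0 j else a.
Proof.
rewrite /rV_cons/=; case: unliftP => [j ->|->].
  rewrite (_ : lift ord0 j = rshift 1 j); last exact: val_inj.
  by rewrite (@row_mxEr _ 1 1 n).
rewrite (_ : (ord0 : 'I_n.+1) = lshift n (ord0 : 'I_1)); last exact: val_inj.
by rewrite (@row_mxEl _ 1 1 n) mxE eqxx mulr1n.
Qed.

Lemma affine_rV_cons n (s : R) (a b : R) (v w : 'rV[R]_n) :
  (s *: rV_cons (a, v) + rV_cons (b, w) = rV_cons (s * a + b, s *: v + w))%R.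
Proof.
apply/rowP => i; rewrite [LHS]mxE [X in (X + _)%R]mxE !rV_consE.
by case: unliftP => [j _|_] //=; rewrite !mxE.
Qed.

Lemma measurable_rV_cons_tail n (a : R) :
  measurable_fun setT (fun v : 'rV[R]_n => rV_cons (a, v)).
Proof.
apply: measurable_fun_rV => i.
under eq_fun do rewrite rV_consE.
by case: unliftP => [j _|_]; [exact: (@measurable_coord n j)|exact: measurable_cst].
Qed.

(** Induction on the dimension by Tonelli, peeling off the first coordinate. *)
Lemma ge0_integral_affine_rV n (s : R) (b : 'rV[R]_n) (f : 'rV[R]_n -> \bar R) :
  (0 < s)%R ->
  measurable_fun setT f -> (forall x, 0 <= f x) ->
  \int[@lebesgue_rV R n]_z f z =
  (s ^+ n)%:E * \int[@lebesgue_rV R n]_z f (s *: z + b)%R.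
Proof.
move=> s0; elim: n b f => [|n IH] b f mf f0.
  rewrite expr0 mul1e; apply: eq_integral => z _; congr f.
  by apply/rowP => -[].
have [g gK Kg] := @rV_cons_bij R n.
have -> : b = rV_cons (g b) by rewrite Kg.
case: (g b) => {gK Kg g b} b w.
rewrite !ge0_integral_rVS//; last first.
  by apply: measurableT_comp => //; exact: measurable_affine_rV.
under [in RHS]eq_integral do under eq_integral do rewrite affine_rV_cons.
pose G a := \int[@lebesgue_rV R n]_v f (rV_cons (a, v)).
have mG : measurable_fun [set: measurableTypeR R] G.
  apply: (measurable_fun_fubini_tonelli_F (f \o @rV_cons R n)) => [|p]; last exact: f0.
  exact: measurableT_comp mf (@measurable_rV_cons R n).
have G0 a : 0 <= G a by exact: integral_ge0.
transitivity (\int[lambda]_a G a) => //.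
rewrite (@ge0_integral_affine s b G s0 mG G0) exprS EFinM -muleA; congr *%E.
rewrite -ge0_integralZl//; last 3 first.
  - pose h (p : measurableTypeR R * 'rV[R]_n) := f (rV_cons ((s * p.1 + b)%R, (s *: p.2 + w)%R)).
    apply: (measurable_fun_fubini_tonelli_F h) => // [|x]; last exact: f0.
    apply: (measurableT_comp mf).
    have -> : (fun p : measurableTypeR R * 'rV[R]_n =>
        rV_cons ((s * p.1 + b)%R, (s *: p.2 + w)%R)) =
      (fun z => (s *: z + rV_cons (b, w))%R) \o @rV_cons R n.
      by apply/funext => -[x v] /=; rewrite affine_rV_cons.
    apply: measurableT_comp; last exact: measurable_rV_cons.
    exact: measurable_affine_rV.
  - by move=> x _; exact: integral_ge0.
  - by rewrite lee_fin exprn_ge0// ltW.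
apply: eq_integral => a _; rewrite /G (IH w)//.
by apply: measurableT_comp => //; exact: measurable_rV_cons_tail.
Qed.

End affine.

(** * Borel sets, the Euclidean norm and the measure of boxes *)

Section topo.
Context {R : realType} {n : nat}.
Implicit Types (x y z : 'rV[R]_n) (A : set 'rV[R]_n).
Local Notation mu := (@lebesgue_rV R n).

Lemma rV_norm_ltP (x : 'rV[R]_n) (e : R) :
  `|x| < e <-> 0 < e /\ forall i, `|x ord0 i| < e.
Proof.
have := @mx_norm_ball R 1 n; move=> /(congr1 (fun f => f 0 e x)).
rewrite /ball_ /= sub0r normrN => <-; split=> -[e0 h]; split=> // i.
  by have := h ord0 i; rewrite mxE /ball/= sub0r normrN.
by move=> j; rewrite (ord1 i) mxE /ball/= sub0r normrN.
Qed.

Lemma ler_coord_norm (x : 'rV[R]_n) i : `|x ord0 i| <= `|x|.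
Proof.
apply/ler_addgt0Pr => e e0; apply: ltW.
have /rV_norm_ltP[_] : `|x| < `|x| + e by rewrite ltrDl.
exact.
Qed.

(** The sigma-algebra is generated by the coordinates, so boxes are measurable, and
    an open set is the countable union of the rational boxes that it contains. *)
Lemma open_measurable_rV A : open A -> measurable A.
Proof.
move=> oA.
pose box (p : 'rV[rat]_n * nat) := [set x : 'rV[R]_n | forall i,
  `|x ord0 i - ratr (p.1 ord0 i)| < (p.2.+1%:R)^-1].
have mbox p : measurable (box p).
  rewrite (_ : box p = \bigcap_(i in [set: 'I_n])
    ((fun x : 'rV[R]_n => x ord0 i : measurableTypeR R) @^-1`
     [set t | `|t - ratr (p.1 ord0 i)| < (p.2.+1%:R)^-1])); last first.
    by apply/seteqP; split=> x /= h i; move: (h i) => //; exact.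
  apply: fin_bigcap_measurable; first exact: finite_finset.
  move=> i _; rewrite -[X in measurable X]setTI; apply: (@measurable_coord R n i) => //.
  rewrite (_ : mkset _ = ball (ratr (p.1 ord0 i) : R) (p.2.+1%:R)^-1).
    exact: measurable_ball.
  by apply/seteqP; split=> t; rewrite /ball/= distrC.
pose F (p : 'rV[rat]_n * nat) := if `[< box p `<=` A >] then box p else set0.
have -> : A = \bigcup_p F p.
  apply/seteqP; split=> [x Ax|x [p _]]; last first.
    by rewrite /F; case: asboolP => // + pbx; exact.
  have /nbhs_ballP[e /= e0 eA] : nbhs x A by exact: open_nbhs_nbhs.
  have [k ke] : exists k : nat, (k.+1%:R)^-1 < e / 2.
    have e20 : 0 < e / 2 by rewrite divr_gt0.
    have := @near_infty_natSinv_lt R (PosNum e20) => -[k _ h].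
    by exists k; exact: (h k (leqnn _)).
  have k0 : 0 < (k.+1%:R : R)^-1 by rewrite invr_gt0.
  have q_ i : {q : rat | `|x ord0 i - ratr q| < (k.+1%:R)^-1}.
    apply: cid.
    move: k0; move: (k.+1%:R^-1 : R) => d d0.
    have : x ord0 i - d < x ord0 i + d by lra.
    move=> /rat_in_itvoo[q]; rewrite in_itv/= => /andP[q1 q2]; exists q.
    by rewrite ltr_norml; apply/andP; split; lra.
  pose q : 'rV[rat]_n := \row_i sval (q_ i).
  have bx : box (q, k) x.
    by move=> i /=; rewrite mxE; exact: svalP (q_ i).
  exists (q, k) => //; rewrite /F; case: asboolP => // -[] y yb; apply: eA.
  rewrite -ball_normE /ball_/= rV_norm_ltP; split=> // i; rewrite !mxE.
  move: ke (bx i) (yb i); rewrite /=; move: (k.+1%:R^-1 : R) => d ke.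
  rewrite /= !ltr_norml => /andP[b1 b2] /andP[a1 a2].
  by apply/andP; split; lra.
apply: countable_bigcupT_measurable => [|p]; first exact: countableP.
by rewrite /F; case: ifP.
Qed.

Lemma closed_measurable_rV A : closed A -> measurable A.
Proof.
move=> cA; rewrite -(setCK A); apply: measurableC; apply: open_measurable_rV.
exact: closed_openC. Qed.

Lemma compact_closed_rV A : compact A -> closed A.
Proof. by apply: compact_closed; exact: norm_hausdorff. Qed.

Lemma closed_set1_rV x : closed [set x].
Proof.
by apply: accessible_closed_set1; apply: hausdorff_accessible; exact: norm_hausdorff.
Qed.

Lemma enorm_ge0 x : 0 <= enorm x. Proof. exact: sqrtr_ge0. Qed.

Lemma enorm_sqr x : enorm x ^+ 2 = \sum_(i < n) x ord0 i ^+ 2.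
Proof. by rewrite sqr_sqrtr// sumr_ge0// => i _; exact: sqr_ge0. Qed.

Lemma enormZ (s : R) x : enorm (s *: x) = `|s| * enorm x.
Proof.
rewrite /enorm -sqrtr_sqr -sqrtrM ?sqr_ge0//; congr Num.sqrt.
by rewrite mulr_sumr; apply: eq_bigr => i _; rewrite mxE exprMn.
Qed.

Lemma enormN x : enorm (- x) = enorm x.
Proof. by rewrite -scaleN1r enormZ normrN1 mul1r. Qed.

Lemma enormB x y : enorm (x - y) = enorm (y - x).
Proof. by rewrite -enormN opprB. Qed.

Lemma coord_le_enorm x i : `|x ord0 i| <= enorm x.
Proof.
rewrite -sqrtr_sqr ler_wsqrtr// (bigD1 i)//= lerDl.
by apply: sumr_ge0 => j _; exact: sqr_ge0.
Qed.

(** Together with [enorm_le_norm], this lets the sup norm serve for the topology and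
    the Euclidean norm for the kernel. *)
Lemma norm_le_enorm x : `|x| <= enorm x.
Proof.
apply/ler_addgt0Pr => e e0; apply: ltW; apply/rV_norm_ltP; split.
  by rewrite ltr_wpDl// enorm_ge0.
by move=> i; rewrite (le_lt_trans (coord_le_enorm _ _))// ltrDl.
Qed.

Lemma enorm_le_norm x : enorm x <= n%:R * `|x|.
Proof.
rewrite -[leRHS]ger0_norm ?mulr_ge0// -sqrtr_sqr ler_wsqrtr//.
apply: (@le_trans _ _ (\sum_(i < n) `|x| ^+ 2)).
  apply: ler_sum => i _; rewrite -real_normK ?num_real//.
  by rewrite lerXn2r ?nnegrE// ler_coord_norm.
rewrite sumr_const card_ord -[leLHS]mulr_natl exprMn ler_wpM2r ?sqr_ge0//.
by rewrite -natrX ler_nat; case: (n) => // k; rewrite expnS leq_pmulr.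
Qed.

Lemma enorm_eq0 x : (enorm x == 0) = (x == 0).
Proof.
apply/idP/idP => [/eqP h|/eqP ->].
  by rewrite -normr_le0 (le_trans (norm_le_enorm x))// h.
by rewrite -(scale0r 0) enormZ normr0 mul0r.
Qed.

Lemma enorm_gt0 x : (0 < enorm x) = (x != 0).
Proof. by rewrite lt0r enorm_ge0 enorm_eq0 andbT. Qed.

Lemma enorm_continuous : continuous (@enorm R n).
Proof.
have H : continuous (fun x : 'rV[R]_n => \sum_(i < n) x ord0 i ^+ 2).
  apply: continuous_big => [|i _ x]; first exact: add_continuous.
  apply: (@continuous_comp _ _ _ (fun x : 'rV[R]_n => x ord0 i) (fun t => t ^+ 2)).
    exact: coord_continuous.
  exact: exprn_continuous.
move=> x; apply: continuous_comp; [exact: H|exact: sqrt_continuous].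
Qed.

Lemma measurable_enorm :
  measurable_fun setT (fun x : 'rV[R]_n => enorm x : measurableTypeR R).
Proof.
rewrite /enorm.
apply: (@measurableT_comp _ _ _ _ _ _ (Num.sqrt : measurableTypeR R -> measurableTypeR R)).
  by apply: continuous_measurable_fun; exact: sqrt_continuous.
apply: measurable_sum => i.
by apply: measurable_funX; exact: measurable_coord.
Qed.

Lemma measurable_enorm_itv (i : interval R) :
  measurable [set u : 'rV[R]_n | enorm u \in i].
Proof.
rewrite -[X in measurable X]setTI.
by apply: (measurable_enorm measurableT [set` i]); exact: measurable_itv.
Qed.

Lemma measurable_enorm_lt (r : R) : measurable [set z : 'rV[R]_n | enorm z < r].
Proof.
rewrite (_ : mkset _ = [set z | enorm z \in `]-oo, r[]).
  exact: measurable_enorm_itv.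
by apply/seteqP; split => z /=; rewrite in_itv.
Qed.

Lemma ge0_integral_translate (b : 'rV[R]_n) (f : 'rV[R]_n -> \bar R) :
  measurable_fun setT f -> (forall x, (0 <= f x)%E) ->
  (\int[mu]_z f z = \int[mu]_z f (z + b)%R)%E.
Proof.
move=> mf f0; rewrite (@ge0_integral_affine_rV R n 1 b)// expr1n mul1e.
by under eq_integral do rewrite scale1r.
Qed.

Lemma mu_affine (s : R) (b : 'rV[R]_n) A : 0 < s -> measurable A ->
  (mu A = (s ^+ n)%:E * mu [set z | A (s *: z + b)%R])%E.
Proof.
move=> s0 mA.
have mB : measurable [set z | A (s *: z + b)].
  by rewrite -[X in measurable X]setTI; exact: measurable_affine_rV.
rewrite -[in LHS](setIT A) -integral_indic// (@ge0_integral_affine_rV R n s b)//.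
  by rewrite -[in RHS](setIT [set z | _]) -integral_indic.
by apply/measurable_EFinP; exact: measurable_indic.
Qed.

Lemma mu_translate (b : 'rV[R]_n) A : measurable A ->
  (mu A = mu [set z | A (z + b)%R])%E.
Proof.
move=> mA; rewrite (@mu_affine 1 b)// expr1n mul1e; congr (mu _).
by apply/seteqP; split=> z /=; rewrite scale1r.
Qed.

End topo.

Lemma measurable_box {R : realType} n (r : R) :
  measurable [set x : 'rV[R]_n | forall i, `|x ord0 i| < r].
Proof.
rewrite (_ : mkset _ = \bigcap_(i in [set: 'I_n])
    ((fun x : 'rV[R]_n => x ord0 i : measurableTypeR R) @^-1` ball 0 r)).
  apply: fin_bigcap_measurable; first exact: finite_finset.
  move=> i _; rewrite -[X in measurable X]setTI; apply: (@measurable_coord R n i) => //.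
  exact: measurable_ball.
by apply/seteqP; split=> x /= h i; move: (h i); rewrite /ball/= sub0r normrN //; exact.
Qed.

Lemma mu_box {R : realType} n (r : R) : 0 < r ->
  @lebesgue_rV R n [set x | forall i, `|x ord0 i| < r] = ((2 * r) ^+ n)%:E.
Proof.
move=> r0; elim: n => [|n IH].
  rewrite /= diracE mem_set//.
  by move=> [].
rewrite /= /pushforward.
rewrite (_ : _ @^-1` _ = ball (0 : R) r `*` [set x : 'rV[R]_n | forall i, `|x ord0 i| < r]).
  rewrite product_measure1E/=; [|exact: measurable_ball|exact: measurable_box].
  rewrite IH lebesgue_measure_ball ?ltW// exprS EFinM; congr (_ * _)%E.
  by rewrite mulr2n mulrDl mul1r.
apply/seteqP; split=> -[a v] /=.
  move=> h; split.
    by have := h ord0; rewrite rV_consE unlift_none /ball/= sub0r normrN.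
  by move=> i; have := h (lift ord0 i); rewrite rV_consE liftK.
rewrite /ball/= sub0r normrN => -[h1 h2] i; rewrite rV_consE.
by case: unliftP.
Qed.

Section topo2.
Context {R : realType} {n : nat}.
Implicit Types (x y z : 'rV[R]_n) (A : set 'rV[R]_n).
Local Notation mu := (@lebesgue_rV R n).

Lemma mu_ball x (r : R) : 0 < r -> mu (ball x r) = ((2 * r) ^+ n)%:E.
Proof.
move=> r0; rewrite (mu_translate x); last first.
  by apply: open_measurable_rV; exact: ball_open.
rewrite -(mu_box n _ r0); congr (mu _); apply/seteqP; split=> z /=.
  by rewrite -ball_normE /ball_/= opprD addrCA subrr addr0 normrN rV_norm_ltP => -[].
move=> h; rewrite -ball_normE /ball_/= opprD addrCA subrr addr0 normrN.
by apply/rV_norm_ltP.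
Qed.

Lemma mu_bounded_lty A : bounded_set A -> measurable A -> (mu A < +oo)%E.
Proof.
move=> [M [Mr MA]] mA.
have M1 : M < `|M| + 1 by rewrite (le_lt_trans (ler_norm _))// ltrDl.
have bA : A `<=` ball (0 : 'rV[R]_n) (`|M| + 2).
  move=> x /(MA _ M1) h; rewrite -ball_normE /ball_/= sub0r normrN.
  by rewrite (le_lt_trans h)// ltrD2l ltr1n.
apply: (@le_lt_trans _ _ (mu (ball (0 : 'rV[R]_n) (`|M| + 2)))).
  apply: le_measure => //; rewrite inE//.
  by apply: open_measurable_rV; exact: ball_open.
by rewrite mu_ball ?ltry// ltr_wpDl.
Qed.

Lemma mu_open_gt0 A : open A -> A !=set0 -> (0 < mu A)%E.
Proof.
move=> oA [x Ax].
have /nbhs_ballP[e /= e0 eA] : nbhs x A by exact: open_nbhs_nbhs.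
apply: (@lt_le_trans _ _ (mu (ball x e))).
  by rewrite mu_ball// lte_fin exprn_gt0// mulr_gt0.
apply: le_measure => //; rewrite inE; last exact: open_measurable_rV.
by apply: open_measurable_rV; exact: ball_open.
Qed.

Lemma mu_set1 x : (0 < n)%N -> mu [set x] = 0%E.
Proof.
move=> n0; apply/eqP; rewrite eq_le measure_ge0 andbT.
apply/lee_addgt0Pr => e e0; rewrite add0e.
have [r [r0 re]] : exists r : R, 0 < r /\ (2 * r) ^+ n <= e.
  exists (Num.min 1 e / 2); have m0 : 0 < Num.min 1 e by rewrite lt_min ltr01.
  split; first by rewrite divr_gt0.
  rewrite mulrC divfK ?pnatr_eq0//.
  have m1 : Num.min 1 e <= 1 by rewrite ge_min lexx.
  apply: (@le_trans _ _ (Num.min 1 e)); last by rewrite ge_min lexx orbT.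
  by rewrite -[leRHS]expr1 ler_wiXn2l// ltW.
apply: (@le_trans _ _ (mu (ball x r))).
  apply: le_measure; rewrite ?inE.
  - by apply: closed_measurable_rV; exact: closed_set1_rV.
  - by apply: open_measurable_rV; exact: ball_open.
  - by move=> _ ->; exact: ballxx.
by rewrite mu_ball// lee_fin.
Qed.

End topo2.

(** * Powers, logarithms and the Gamma function on the half-line *)

Section oned.
Context {R : realType}.
Local Notation lambda := (@lebesgue_measure R).
Implicit Types (a b s : R).

(** The primitive of [s `^ (alpha - 1)] on the positive half-line, with the
    logarithm at [alpha = 0]. *)
Definition powR_prim (alpha s : R) : R :=
  if alpha == 0 then ln s else s `^ alpha / alpha.

Lemma is_derive_powR_prim (alpha s : R) : 0 < s ->
  is_derive s 1 (powR_prim alpha) (s `^ (alpha - 1)).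
Proof.
move=> s0; rewrite /powR_prim; case: eqVneq => [->|a0].
  by rewrite sub0r powR_inv1 ?ltW//; exact: is_derive1_ln.
have h : is_derive s 1 (fun t : R => t `^ alpha) (alpha * s `^ (alpha - 1)).
  exact: is_derive1_powR.
have -> : (fun s : R => s `^ alpha / alpha) = (alpha^-1 \*: (fun t : R => t `^ alpha)).
  by apply/funext => t /=; rewrite mulrC.
apply: is_derive_eq; rewrite /GRing.scale/= mulrA mulVf// mul1r//.
Qed.

Lemma continuous_powR (p s : R) : 0 < s -> {for s, continuous (fun t : R => t `^ p)}.
Proof.
move=> s0; apply: differentiable_continuous; apply/derivable1_diffP.
by apply: derivable_powR; rewrite in_itv/= s0.
Qed.

Lemma integral_powR (alpha a b : R) : 0 < a -> a <= b ->
  (\int[lambda]_(s in `[a, b]) (s `^ (alpha - 1))%:E =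
   (powR_prim alpha b - powR_prim alpha a)%:E)%E.
Proof.
move=> a0; rewrite le_eqVlt => /predU1P[<-|ab].
  by rewrite set_itv1 integral_set1 subrr.
have cF s : 0 < s -> {for s, continuous (powR_prim alpha)}.
  move=> s0; apply: differentiable_continuous; apply/derivable1_diffP.
  by have [] := is_derive_powR_prim alpha s s0.
rewrite (@continuous_FTC2 _ _ (powR_prim alpha))// ?EFinB//.
- apply: continuous_in_subspaceT => s; rewrite inE/= in_itv/= => /andP[h _].
  by apply: continuous_powR; exact: lt_le_trans h.
- split.
  + move=> s; rewrite in_itv/= => /andP[h _].
    by have [] := is_derive_powR_prim alpha s (lt_trans a0 h).
  + by apply: cvg_at_right_filter; exact: cF.
  + by apply: cvg_at_left_filter; apply: cF; exact: lt_trans ab.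
- move=> s; rewrite in_itv/= => /andP[h _].
  rewrite derive1E.
  by have [] := is_derive_powR_prim alpha s (lt_trans a0 h).
Qed.

Lemma integral_inv a b : 0 < a -> a <= b ->
  (\int[lambda]_(s in `]a, b[) (s^-1)%:E = (ln b - ln a)%:E)%E.
Proof.
move=> a0 ab; have := integral_powR 0 a b a0 ab; rewrite /powR_prim eqxx => <-.
rewrite [RHS]integral_itv_bndoo//.
  apply: eq_integral => s; rewrite inE/= in_itv/= => /andP[h _].
  by rewrite sub0r powR_inv1// ltW// (lt_trans a0).
apply/measurable_EFinP; apply: measurable_funTS; exact: measurable_powR.
Qed.

(** Up to the factor 2 this is [Gamma (n / 2)] (see [Gamma_gauss_moment]), in the form
    in which it appears in a Gaussian integral in polar coordinates. *)
Definition gauss_moment n : \bar R :=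
  (\int[lambda]_(s in `]0%R, +oo[) (s ^+ n.-1 * expR (- s ^+ 2))%:E)%E.

Lemma measurable_gauss_moment n :
  measurable_fun [set: R] (fun s : R => s ^+ n * expR (- s ^+ 2)).
Proof.
apply: measurable_funM; first exact: measurable_funX.
apply: measurableT_comp; first exact: measurable_expR.
by apply: measurable_funN; exact: measurable_funX.
Qed.

(** Substitution [t = s ^ 2], on compact intervals away from 0. *)
Lemma Gamma_integrand_subst n a b : (0 < n)%N -> 0 < a -> a < b ->
  (\int[lambda]_(t in `[(a ^+ 2)%R, (b ^+ 2)%R])
     (t `^ (n%:R / 2 - 1) * expR (- t))%:E =
   2%:E * \int[lambda]_(s in `[a, b]) (s ^+ n.-1 * expR (- s ^+ 2))%:E)%E.
Proof.
move=> n0 a0 ab.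
have b0 : 0 < b by exact: lt_trans ab.
have dF (x : R) : is_derive x 1 (fun s : R => s ^+ 2) (2 * x).
  by apply: is_derive_eq; rewrite /GRing.scale/= !mulr1 -mulr2n mulr_natl.
have F' : (fun s : R => s ^+ 2)^`()%classic = (fun x => 2 * x).
  by apply/funext => x; rewrite derive1E; have [] := dF x.
have cF' : continuous (fun x : R => 2 * x) by exact: mulrl_continuous.
have cF : continuous (fun x : R => x ^+ 2) by exact: exprn_continuous.
rewrite (@integration_by_substitution_increasing R (fun s => s ^+ 2)
  (fun t => t `^ (n%:R / 2 - 1) * expR (- t)))//.
- rewrite -ge0_integralZl//=; last 2 first.
  + apply/measurable_EFinP; apply: measurable_funTS; exact: measurable_gauss_moment.
  + move=> s; rewrite in_itv/= => /andP[h _]; rewrite lee_fin.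
    by rewrite mulr_ge0 ?expR_ge0// exprn_ge0// (le_trans (ltW a0)).
  apply: eq_integral => s; rewrite inE/= in_itv/= => /andP[h _].
  have s0 : 0 < s by exact: lt_le_trans h.
  rewrite fctE F' -EFinM; congr EFin => /=.
  have -> : (s ^+ 2) `^ (n%:R / 2 - 1) = s `^ (n%:R - 2).
    by rewrite -powR_mulrn ?ltW// -powRrM; congr (_ `^ _); lra.
  have -> : s `^ (n%:R - 2) = s ^+ n.-1 / s.
    have -> : n%:R - 2 = n.-1%:R - 1 :> R.
      by rewrite -[in LHS](prednK n0) -natr1; lra.
    rewrite powRB; last by rewrite (gt_eqF s0) implybT.
    by rewrite powRr1 ?ltW// powR_mulrn ?ltW.
  field.
  by rewrite gt_eqF.
- exact: ltW.
- move=> x y; rewrite !in_itv/= => /andP[ax _] /andP[ay _] xy.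
  by rewrite ltrXn2r// ?nnegrE (le_trans (ltW a0)).
- by rewrite F' => x _; exact: cF'.
- by rewrite F'; apply/cvg_ex; exists (2 * a); apply: cvg_at_right_filter; exact: cF'.
- by rewrite F'; apply/cvg_ex; exists (2 * b); apply: cvg_at_left_filter; exact: cF'.
- split.
  + by move=> x _; have [] := dF x.
  + by apply: cvg_at_right_filter; exact: cF.
  + by apply: cvg_at_left_filter; exact: cF.
- apply: continuous_in_subspaceT => s; rewrite inE/= in_itv/= => /andP[h _].
  have s0 : 0 < s by rewrite (lt_le_trans _ h)// exprn_gt0.
  apply: cvgM; first exact: continuous_powR.
  by apply: continuous_comp; [exact: continuousN|exact: continuous_expR].
Qed.

Lemma bigcup_itv_inv (f : nat -> R) :
  (forall x, 0 < x -> exists k, f k <= x <= (f k)^-1) -> (forall k, 0 < f k) ->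
  \bigcup_k `[f k, (f k)^-1]%classic = `]0, +oo[%classic :> set R.
Proof.
move=> fx f0; apply/seteqP; split=> [x [k _]/=|x /=].
  by rewrite !in_itv/= andbT => /andP[h _]; exact: lt_le_trans h.
by rewrite in_itv/= andbT => /fx[k kx]; exists k => //=; rewrite in_itv.
Qed.

(** The substitution [t = s ^ 2] on the whole half-line, by exhaustion: the intervals
    [[f ^ 2, f ^ -2]] and [[f, f ^ -1]] increase to it as [f] decreases to 0. *)
Lemma Gamma_gauss_moment n : (0 < n)%N ->
  (\int[lambda]_(t in `]0%R, +oo[) (t `^ (n%:R / 2 - 1) * expR (- t))%:E =
   2%:E * gauss_moment n)%E.
Proof.
move=> n0.
pose f k : R := (k.+2%:R)^-1.
have f0 k : 0 < f k by rewrite invr_gt0.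
have ff k : f k < (f k)^-1.
  by rewrite invrK (@lt_trans _ _ 1)// ?invf_lt1// ltr1n.
have fle k l : (k <= l)%N -> f l <= f k.
  by move=> kl; rewrite lef_pV2 ?posrE// ler_nat.
have ex_f x : 0 < x -> exists k, f k <= x <= (f k)^-1.
  move=> x0; pose k := maxn (Num.bound x) (Num.bound x^-1).
  exists k; rewrite invrK; apply/andP; split.
    rewrite -[leRHS]invrK lef_pV2 ?posrE ?invr_gt0//.
    have h : x^-1 < (Num.bound x^-1)%:R by rewrite archi_boundP// invr_ge0 ltW.
    apply: (le_trans (ltW h)); rewrite ler_nat -addn2.
    exact: leq_trans (leq_maxr (Num.bound x) _) (leq_addr _ _).
  have h : x < (Num.bound x)%:R by rewrite archi_boundP// ltW.
  apply: (le_trans (ltW h)); rewrite ler_nat -addn2.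
  exact: leq_trans (leq_maxl _ (Num.bound x^-1)) (leq_addr _ _).
have ndE (g : nat -> R) : (forall k, 0 < g k) -> (forall k l, (k <= l)%N -> g l <= g k) ->
    nondecreasing_seq (fun k => `[g k, (g k)^-1]%classic).
  move=> g0 gle k l kl; apply/subsetPset => x /=; rewrite !in_itv/= => /andP[h1 h2].
  by rewrite (le_trans (gle _ _ kl) h1)/= (le_trans h2)// lef_pV2 ?posrE// gle.
have f20 k : 0 < f k ^+ 2 by rewrite exprn_gt0.
have f2le k l : (k <= l)%N -> f l ^+ 2 <= f k ^+ 2.
  by move=> kl; apply: lerXn2r; rewrite ?nnegrE ?(ltW (f0 _))//; exact: fle.
have ex_f2 x : 0 < x -> exists k, f k ^+ 2 <= x <= (f k ^+ 2)^-1.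
  move=> x0; have [k /andP[h1 h2]] := ex_f x x0; exists k.
  have f1 : f k <= 1 by rewrite invf_le1 ?ler1n.
  apply/andP; split.
    by rewrite (le_trans _ h1)// expr2 ler_piMl// ltW.
  by rewrite (le_trans h2)// lef_pV2 ?posrE// expr2 ler_piMl// ltW.
have H1 := @ge0_nondecreasing_set_cvg_integral _ _ R
  (fun k => `[f k ^+ 2, (f k ^+ 2)^-1]%classic : set (measurableTypeR R))
  (fun t => (t `^ (n%:R / 2 - 1) * expR (- t))%:E) lambda
  (ndE (fun k => f k ^+ 2) f20 f2le).
have H2 := @ge0_nondecreasing_set_cvg_integral _ _ R
  (fun k => `[f k, (f k)^-1]%classic : set (measurableTypeR R))
  (fun s => (s ^+ n.-1 * expR (- s ^+ 2))%:E) lambda (ndE f f0 fle).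
rewrite !bigcup_itv_inv// in H1 H2.
have {}H1 := H1 (fun _ => measurable_itv _).
have {}H2 := H2 (fun _ => measurable_itv _).
rewrite -(cvg_lim _ (H1 _ _))//; last 2 first.
- move=> k; apply/measurable_EFinP; apply: measurable_funTS.
  apply: measurable_funM; first exact: measurable_powR.
  apply: measurableT_comp; first exact: measurable_expR.
  exact: measurable_funN.
- by move=> k x _; rewrite lee_fin mulr_ge0 ?powR_ge0 ?expR_ge0.
apply/cvg_lim => //.
have -> : (fun k => \int[lambda]_(x in `[(f k ^+ 2)%R, (f k ^+ 2)^-1%R])
      (x `^ (n%:R / 2 - 1) * expR (- x))%:E)%E =
    (fun k => 2%:E * \int[lambda]_(s in `[f k, (f k)^-1%R]) (s ^+ n.-1 * expR (- s ^+ 2))%:E)%E.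
  by apply/funext => k; rewrite -(Gamma_integrand_subst n _ _ n0 (f0 k) (ff k)) (exprVn (f k) 2).
apply: cvgeZl => //; apply: H2 => //.
- move=> k; apply/measurable_EFinP; apply: measurable_funTS.
  exact: measurable_gauss_moment.
- move=> k x /=; rewrite in_itv/= => /andP[h _].
  by rewrite lee_fin mulr_ge0 ?expR_ge0// exprn_ge0// (le_trans (ltW (f0 k))).
Qed.

End oned.

(** * Polar coordinates *)

Section polar.
Context {R : realType} {n : nat}.
Local Notation lambda := (@lebesgue_measure R).
Local Notation mu := (@lebesgue_rV R n).
Local Notation mR := (measurableTypeR R).
Implicit Types (x y z u : 'rV[R]_n) (s : R) (K : 'rV[R]_n -> \bar R).

(** A stand-in for the unit sphere. Every open half-line from 0 meets it in an
    interval of logarithmic length 1, so integrating over it with weight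
    [|u| ^ - n] is integrating over directions. *)
Definition annulus := [set u : 'rV[R]_n | 1 < enorm u < expR 1].

Lemma measurable_annulus : measurable annulus.
Proof.
rewrite (_ : annulus = [set u | enorm u \in `]1, expR 1[]).
  exact: measurable_enorm_itv.
by apply/seteqP; split => u /=; rewrite in_itv.
Qed.

Lemma in_annulus u : (u \in annulus) = (1 < enorm u < expR 1).
Proof. by apply/idP/idP; rewrite inE. Qed.

Lemma measurable_scale :
  measurable_fun setT (fun p : mR * 'rV[R]_n => (p.1 : R) *: p.2).
Proof.
apply: measurable_fun_rV => i.
under eq_fun do rewrite mxE.
apply: measurable_funM; first exact: measurable_fst.
apply: (@measurableT_comp _ _ _ _ _ _ (fun x : 'rV[R]_n => x ord0 i : mR)).
  exact: measurable_coord.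
exact: measurable_snd.
Qed.

Lemma measurable_inv_pos :
  measurable_fun (`]0%R, +oo[%classic : set R) (fun s : R => s^-1).
Proof.
apply: open_continuous_measurable_fun; first exact: interval_open.
move=> s; rewrite inE/= in_itv/= andbT => s0.
by apply: inv_continuous; rewrite gt_eqF.
Qed.

Local Open Scope ereal_scope.

Definition ray_integral K u : \bar R :=
  \int[lambda]_(s in `]0%R, +oo[) ((s ^+ n.-1)%:E * K (s *: u)).

Lemma measurable_ray_integral K : measurable_fun setT K -> (forall z, 0 <= K z) ->
  measurable_fun setT (ray_integral K).
Proof.
move=> mK K0.
pose P : set R := `]0%R, +oo[%classic.
pose H (p : mR * 'rV[R]_n) := (\1_P p.1 * p.1 ^+ n.-1)%:E * K (p.1 *: p.2).
have mH : measurable_fun setT H.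
  apply: emeasurable_funM; last exact: measurableT_comp mK measurable_scale.
  apply/measurable_EFinP; apply: measurable_funM.
    apply: (@measurableT_comp _ _ _ _ _ _ (\1_P : mR -> R)); last exact: measurable_fst.
    by apply: measurable_indic; exact: measurable_itv.
  by apply: measurable_funX; exact: measurable_fst.
have H0 p : 0 <= H p.
  rewrite /H mule_ge0// lee_fin indicE.
  case: (boolP (p.1 \in P)) => [|_]; last by rewrite mul0r.
  by rewrite inE /P/= in_itv/= andbT => s0; rewrite mul1r exprn_ge0// ltW.
have := measurable_fun_fubini_tonelli_G (m1 := lambda) H mH H0.
congr (measurable_fun _ _); apply/funext => u.
rewrite /fubini_G /ray_integral [RHS]integral_mkcond; apply: eq_integral => s _.
by rewrite /patch /H/= indicE -/P; case: ifP => _; rewrite ?mul1r// mul0r mul0e.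
Qed.

Let P : set R := `]0%R, +oo[%classic.
Let w (s : R) : R := (\1_P s * s^-1)%R.

Let mw : measurable_fun [set: mR] w.
Proof.
rewrite (_ : w = (fun s => s^-1)%R \_ `]0%R, +oo[).
  by apply/(measurable_restrictT _ _).1 => //; exact: measurable_inv_pos.
apply/funext => s; rewrite /w /patch indicE.
by case: ifP; rewrite ?mul1r ?mul0r.
Qed.

(** For [z != 0] the integral of [1 / s] over the [s > 0] with [z / s] in the annulus
    is [ln |z| - ln (|z| / e) = 1]. Insert this factor in the left-hand side,
    exchange the integrals and substitute [z = s u]; the Jacobian [s ^ n] turns
    [1 / s] into [s ^ (n - 1)]. *)
Lemma polar K : (0 < n)%N -> measurable_fun setT K -> (forall z, 0 <= K z) ->
  \int[mu]_z K z =
  \int[mu]_(u in annulus) ray_integral K u.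
Proof.
move=> n0 mK K0.
pose G (p : mR * 'rV[R]_n) :=
  (\1_annulus p.2 * (\1_P p.1 * p.1 ^+ n.-1))%:E * K (p.1 *: p.2).
pose H (p : mR * 'rV[R]_n) :=
  (w p.1 * \1_annulus (w p.1 *: p.2))%:E * K p.2.
have mP : measurable (P : set mR) by exact: measurable_itv.
have mG : measurable_fun setT G.
  apply: emeasurable_funM.
    apply/measurable_EFinP; apply: measurable_funM.
      by apply: (@measurableT_comp _ _ _ _ _ _ (\1_annulus : 'rV[R]_n -> R));
        [by apply: measurable_indic; exact: measurable_annulus|exact: measurable_snd].
    apply: measurable_funM; last by apply: measurable_funX; exact: measurable_fst.
    by apply: (@measurableT_comp _ _ _ _ _ _ (\1_P : mR -> R));
      [exact: measurable_indic|exact: measurable_fst].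
  exact: measurableT_comp mK measurable_scale.
have mwp : measurable_fun setT (fun p : mR * 'rV[R]_n => w p.1).
  exact: measurableT_comp mw measurable_fst.
have mH : measurable_fun setT H.
  apply: emeasurable_funM; last exact: measurableT_comp mK measurable_snd.
  apply/measurable_EFinP; apply: measurable_funM => //.
  apply: (@measurableT_comp _ _ _ _ _ _ (\1_annulus : 'rV[R]_n -> R)).
    apply: measurable_indic; exact: measurable_annulus.
  pose g (p : mR * 'rV[R]_n) : mR * 'rV[R]_n := (w p.1, p.2).
  apply: (@measurableT_comp _ _ _ _ _ _ (fun p : mR * 'rV[R]_n => (p.1 : R) *: p.2)%R _ g).
    exact: measurable_scale.
  exact: measurable_fun_pair mwp measurable_snd.
have w0 s : (0 <= w s)%R.
  rewrite /w indicE; case: (boolP (s \in P)) => [|_]; last by rewrite mul0r.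
  by rewrite inE /P/= in_itv/= andbT => s0; rewrite mul1r invr_ge0 ltW.
have i0 s : (0 <= \1_P s * s ^+ n.-1)%R.
  rewrite indicE; case: (boolP (s \in P)) => [|_]; last by rewrite mul0r.
  by rewrite inE /P/= in_itv/= andbT => s0; rewrite mul1r exprn_ge0 ?ltW.
have G0 p : 0 <= G p by rewrite /G mule_ge0// lee_fin mulr_ge0.
have H0 p : 0 <= H p by rewrite /H mule_ge0// lee_fin mulr_ge0.
have inner s : \int[mu]_u G (s, u) = \int[mu]_z H (s, z).
  have [s0|s0] := ltP 0%R s; last first.
    have sP : (s \in P) = false.
      by apply/negbTE/negP; rewrite inE /P/= in_itv/= andbT ltNge s0.
    rewrite !integral0_eq// => u _; rewrite /G /H /w/= !indicE sP.
      by rewrite !mul0r mul0e.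
    by rewrite !mul0r mulr0 mul0e.
  have sP : s \in P by rewrite inE /P/= in_itv/= andbT.
  have wE : w s = s^-1%R by rewrite /w indicE sP mul1r.
  transitivity (\int[mu]_z ((s ^+ n)%:E * H (s, s *: z + 0)%R)); last first.
    rewrite ge0_integralZl//.
    - rewrite -(@ge0_integral_affine_rV R n s 0 (fun z => H (s, z)))//.
      by apply: measurableT_comp => //; exact: measurable_pair1.
    - apply: (@measurableT_comp _ _ _ _ _ _ (fun z => H (s, z))).
        by apply: measurableT_comp => //; exact: measurable_pair1.
      exact: measurable_affine_rV.
    - by rewrite lee_fin exprn_ge0// ltW.
  apply: eq_integral => u _; rewrite /G /H/= wE addr0 scalerA mulVf ?gt_eqF// scale1r.
  rewrite muleA -EFinM; congr (_%:E * _).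
  have E : (s ^+ n / s = s ^+ n.-1)%R.
    by rewrite -[X in (s ^+ X / s)%R](prednK n0) exprSr mulfK ?gt_eqF.
  by rewrite indicE [\1_P s]indicE sP mul1r mulrA E mulrC.
transitivity (\int[lambda]_s \int[mu]_z H (s, z)); last first.
  transitivity (\int[lambda]_s \int[mu]_z G (s, z)).
    by apply: eq_integral => s _; rewrite inner.
  transitivity (\int[mu]_z \int[lambda]_s G (s, z)).
    exact: (@fubini_tonelli _ _ mR 'rV[R]_n R lambda mu G mG G0).
  rewrite [RHS]integral_mkcond.
  apply: eq_integral => u _; rewrite /patch.
  case: ifPn => [ua|ua]; last first.
    rewrite integral0_eq// => s _.
    by rewrite /G/= indicE (negbTE ua) mul0r mul0e.
  rewrite [RHS]integral_mkcond; apply: eq_integral => s _; rewrite /patch /G/=.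
  rewrite !indicE ua mul1r; case: ifP => _; first by rewrite mul1r.
  by rewrite mul0r mul0e.
transitivity (\int[mu]_z \int[lambda]_s H (s, z)); last first.
  by apply/esym; exact: (@fubini_tonelli _ _ mR 'rV[R]_n R lambda mu H mH H0).
apply: ge0_ae_eq_integral => //.
- have := measurable_fun_fubini_tonelli_G H; apply => //.
- by move=> z _; exact: integral_ge0.
exists [set 0%R]; split.
- by apply: closed_measurable_rV; exact: closed_set1_rV.
- exact: mu_set1.
move=> z /=; apply: contra_notP => z0 _; rewrite /H/=.
have z0' : (0 < enorm z)%R by rewrite enorm_gt0; exact/eqP.
have e1 : (1 < expR 1 :> R)%R by rewrite expR_gt1.
have [Kz|Kz] := eqVneq (K z) 0.
  by rewrite Kz integral0_eq// => s _; rewrite mule0.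
rewrite ge0_integralZr//; last 2 first.
- apply/measurable_EFinP; apply: measurable_funM => //.
  apply: (@measurableT_comp _ _ _ _ _ _ (\1_annulus : 'rV[R]_n -> R)).
    apply: measurable_indic; exact: measurable_annulus.
  apply: (@measurableT_comp _ _ _ _ _ _ (fun p : mR * 'rV[R]_n => (p.1 : R) *: p.2)%R _
    (fun s => (w s, z))).
    exact: measurable_scale.
  exact: measurable_fun_pair mw (measurable_cst _).
- by move=> s _; rewrite lee_fin mulr_ge0.
rewrite -[LHS]mul1e; congr (_ * _); apply/esym.
transitivity (\int[lambda]_(s in `](enorm z / expR 1)%R, enorm z[) (s^-1)%:E).
  rewrite [RHS]integral_mkcond; apply: eq_integral => s _.
  rewrite /patch mem_setE in_itv/=.
  have [s0|s0] := ltP 0%R s; last first.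
    rewrite ifF; last first.
      by apply/negbTE; rewrite negb_and -!leNgt (le_trans s0)// divr_ge0 ?ltW// expR_gt0.
    rewrite /w indicE memNset ?mul0r//.
    by rewrite /P /= in_itv/= andbT ltNge s0.
  have wE : w s = s^-1%R by rewrite /w indicE mem_set ?mul1r// /P/= in_itv/= s0.
  rewrite wE indicE in_annulus enormZ ger0_norm ?invr_ge0 ?ltW//.
  rewrite ltr_pdivrMr ?expR_gt0// -[(1 < _)%R](ltr_pM2l s0) -[(_ < expR 1)%R](ltr_pM2l s0).
  rewrite mulr1 mulrA mulfV ?gt_eqF// mul1r andbC.
  by case: ifP; rewrite ?mulr1// mulr0.
rewrite integral_inv ?divr_gt0 ?expR_gt0// ?ler_pdivrMr ?expR_gt0//.
  rewrite ln_div ?posrE ?expR_gt0// expRK; congr EFin; lra.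
by rewrite ler_peMr// ltW.
Qed.
End polar.

Section radial.
Context {R : realType} {n : nat}.
Local Notation lambda := (@lebesgue_measure R).
Local Notation mu := (@lebesgue_rV R n).
Local Notation mR := (measurableTypeR R).
Implicit Types (x y z u : 'rV[R]_n) (s : R) (K : 'rV[R]_n -> \bar R).
Local Open Scope ereal_scope.

(** The total mass of the directions; [sphere_massE] identifies it with the area of
    the unit sphere. *)
Definition sphere_mass : \bar R := \int[mu]_(u in annulus) (enorm u ^- n)%:E.

Lemma radial_scaling (k : R -> \bar R) (c : R) : (0 < n)%N -> (0 < c)%R ->
  measurable_fun [set: mR] k -> (forall s, 0 <= k s) ->
  \int[lambda]_(s in `]0%R, +oo[) ((s ^+ n.-1)%:E * k (s * c)%R) =
  (c ^- n)%:E * \int[lambda]_(s in `]0%R, +oo[) ((s ^+ n.-1)%:E * k s).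
Proof.
move=> n0 c0 mk k0.
pose F := (fun s : mR => (s ^+ n.-1)%:E * k s) \_ `]0%R, +oo[.
have mF : measurable_fun [set: mR] F.
  apply/(measurable_restrictT _ _).1 => //.
  apply: emeasurable_funM; last exact: measurable_funTS.
  by apply/measurable_EFinP; exact: measurable_funX.
have F0 s : 0 <= F s.
  apply: erestrict_ge0 => {}s /=; rewrite in_itv/= andbT => s0.
  by rewrite mule_ge0// lee_fin exprn_ge0// ltW.
rewrite [in RHS]integral_mkcond -/F (@ge0_integral_affine R c 0%R)//.
rewrite muleA -EFinM -[X in (c ^- X * c)%R](prednK n0) exprSr invfM mulrAC.
rewrite -mulrA mulfV ?gt_eqF// mulr1.
rewrite -ge0_integralZl//; last 2 first.
- exact: (measurableT_comp mF (measurable_affine c 0)).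
- by rewrite lee_fin invr_ge0 exprn_ge0// ltW.
rewrite [LHS]integral_mkcond; apply: eq_integral => s _.
rewrite /F /patch !mem_setE !in_itv/= !andbT addr0 pmulr_rgt0//.
case: ifP => s0; last by rewrite mule0.
rewrite muleA -EFinM exprMn mulrA mulVf ?mul1r ?gt_eqF ?exprn_gt0//.
by rewrite [(c * s)%R]mulrC.
Qed.

Lemma polar_radial (k : R -> \bar R) : (0 < n)%N ->
  measurable_fun [set: mR] k -> (forall s, 0 <= k s) ->
  \int[mu]_z k (enorm z) =
  sphere_mass * \int[lambda]_(s in `]0%R, +oo[) ((s ^+ n.-1)%:E * k s).
Proof.
move=> n0 mk k0.
rewrite (polar (fun z => k (enorm z)))//; last first.
  exact: measurableT_comp mk measurable_enorm.
rewrite /sphere_mass -ge0_integralZr//; last 4 first.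
- exact: measurable_annulus.
- apply/measurable_EFinP; apply: measurable_funTS.
  have -> : (fun u : 'rV[R]_n => (enorm u ^- n)%R) =
      (fun t : R => (t `^ (- n%:R))%R) \o (@enorm R n).
    by apply/funext => u /=; rewrite powR_invn// enorm_ge0.
  apply: measurableT_comp; first exact: measurable_powR.
  exact: measurable_enorm.
- by move=> u _; rewrite lee_fin invr_ge0 exprn_ge0// enorm_ge0.
- apply: integral_ge0 => s /=; rewrite in_itv/= andbT => s0.
  by rewrite mule_ge0// lee_fin exprn_ge0// ltW.
apply: eq_integral => u; rewrite inE => /andP[u1 _].
rewrite -(@radial_scaling k (enorm u))//; last exact: lt_trans u1.
apply: eq_integral => s; rewrite inE/= in_itv/= andbT => s0.
by rewrite enormZ ger0_norm// ltW.
Qed.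
End radial.

(** * The area of the unit sphere *)

Section sphere.
Context {R : realType}.
Local Notation lambda := (@lebesgue_measure R).
Local Notation mR := (measurableTypeR R).
Local Open Scope ereal_scope.

Lemma enorm_rV_cons n (a : R) (v : 'rV[R]_n) :
  (enorm (rV_cons (a, v)) ^+ 2 = a ^+ 2 + enorm v ^+ 2)%R.
Proof.
rewrite !enorm_sqr big_ord_recl rV_consE unlift_none; congr (_ + _)%R.
by apply: eq_bigr => i _; rewrite rV_consE liftK.
Qed.

Lemma measurable_gauss : measurable_fun [set: mR] (fun s : R => (expR (- s ^+ 2))%:E).
Proof.
apply/measurable_EFinP; apply: measurableT_comp; first exact: measurable_expR.
by apply: measurable_funN; exact: measurable_funX.
Qed.

Lemma integral_gauss_rV n :
  \int[@lebesgue_rV R n]_z (expR (- enorm z ^+ 2))%:E = (Num.sqrt pi ^+ n)%:E.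
Proof.
elim: n => [|n IH].
  rewrite [LHS]integral_dirac//.
    by rewrite diracT mul1e /enorm big_ord0 sqrtr0 expr0n/= oppr0 expR0.
  exact: (measurableT_comp measurable_gauss measurable_enorm).
rewrite ge0_integral_rVS//; last first.
  exact: (measurableT_comp measurable_gauss measurable_enorm).
transitivity (\int[lambda]_a ((Num.sqrt pi ^+ n)%:E * (expR (- a ^+ 2))%:E)).
  apply: eq_integral => a _.
  under eq_integral do rewrite enorm_rV_cons opprD expRD EFinM.
  rewrite ge0_integralZl//; last first.
    exact: (measurableT_comp measurable_gauss measurable_enorm).
  by rewrite IH muleC.
rewrite ge0_integralZl//; last first.
  exact: measurable_gauss.
by rewrite [X in _ * X]integralT_gauss -EFinM exprSr.
Qed.

Lemma gauss_moment_ge0 n : 0 <= gauss_moment n :> \bar R.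
Proof.
apply: integral_ge0 => s /=; rewrite in_itv/= andbT => s0.
by rewrite lee_fin mulr_ge0 ?expR_ge0// exprn_ge0// ltW.
Qed.

Lemma sphere_mass_ge0 n : 0 <= @sphere_mass R n.
Proof.
by apply: integral_ge0 => u _; rewrite lee_fin invr_ge0 exprn_ge0// enorm_ge0.
Qed.

(** The Gaussian integral computed in two ways, as a product of one-dimensional
    integrals and in polar coordinates. *)
Lemma sphere_mass_gauss_moment n : (0 < n)%N ->
  @sphere_mass R n * gauss_moment n = (Num.sqrt pi ^+ n)%:E.
Proof.
move=> n0; rewrite -integral_gauss_rV.
rewrite (polar_radial (fun s => (expR (- s ^+ 2))%:E))//.
exact: measurable_gauss.
Qed.

(** Dividing by the Gaussian moment gives
    [pi ^ (n / 2) / (Gamma (n / 2) / 2)]. Neither factor is assumed finite: their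
    product is finite and positive, which forces both to be so. *)
Lemma sphere_massE n : (0 < n)%N ->
  @sphere_mass R n = (sphere_area R n)%:E.
Proof.
move=> n0; have := sphere_mass_gauss_moment n n0.
have pn0 : (0 < Num.sqrt pi ^+ n :> R)%R by rewrite exprn_gt0// sqrtr_gt0 pi_gt0.
have := sphere_mass_ge0 n; have := gauss_moment_ge0 n.
have HG := Gamma_gauss_moment n n0.
move: HG; rewrite /sphere_area /Gamma /Rintegral => ->.
have piE : (pi `^ (n%:R / 2) = Num.sqrt pi ^+ n :> R)%R.
  by rewrite mulrC powRrM powR_mulrn ?powR_ge0// powR12_sqrt// pi_ge0.
case: (gauss_moment n) => [g||]//; case: (sphere_mass) => [s||]//=.
- rewrite !lee_fin => g0 s0 [] E.
  have gn0 : g != 0%R.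
    by apply: contraTneq pn0 => gE; rewrite -E gE mulr0 ltxx.
  by congr EFin; rewrite piE -E; field; rewrite gn0.
- rewrite lee_fin le_eqVlt => /predU1P[<- _|g0 _].
    by rewrite mule0 => -[] E; move: pn0; rewrite -E ltxx.
  by rewrite gt0_mulye.
- move=> _; rewrite lee_fin le_eqVlt => /predU1P[<-|s0].
    by rewrite mul0e => -[] E; move: pn0; rewrite -E ltxx.
  by rewrite gt0_muley.
Qed.

Lemma sphere_area_ge0 n : (0 < n)%N -> (0 <= sphere_area R n)%R.
Proof. by move=> n0; rewrite -lee_fin -sphere_massE// sphere_mass_ge0. Qed.

(** The exact constant matters for [alpha <= 0]: it is the one for which the
    counterterm of the renormalization cancels the divergence as [a] tends to 0. *)
Lemma integral_shell n (alpha a b : R) : (0 < n)%N -> (0 < a)%R -> (a <= b)%R ->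
  \int[@lebesgue_rV R n]_(z in [set z | enorm z \in `[a, b[])
     (enorm z `^ (alpha - n%:R))%:E =
  (sphere_area R n * (powR_prim alpha b - powR_prim alpha a))%:E.
Proof.
move=> n0 a0 ab.
pose k := (fun s : mR => (s `^ (alpha - n%:R))%:E) \_ `[a, b[.
have mk : measurable_fun [set: mR] k.
  apply/(measurable_restrictT _ _).1 => //; apply/measurable_EFinP.
  by apply: measurable_funTS; exact: measurable_powR.
have k0 s : 0 <= k s by apply: erestrict_ge0 => {}s _; rewrite lee_fin powR_ge0.
rewrite integral_mkcond.
transitivity (\int[@lebesgue_rV R n]_z k (enorm z)).
  by apply: eq_integral => z _; rewrite /k /patch !mem_setE.
rewrite polar_radial// sphere_massE// [RHS]EFinM; congr (_ * _).
rewrite -integral_powR// integral_mkcond.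
rewrite -integral_itv_bndo_bndc; last first.
  by apply/measurable_EFinP; apply: measurable_funTS; exact: measurable_powR.
rewrite [RHS]integral_mkcond; apply: eq_integral => s _.
rewrite /k /patch !mem_setE !in_itv/= andbT.
have [s0|s0] := ltP 0%R s; last first.
  by rewrite leNgt (le_lt_trans s0).
case: ifP => h; last by rewrite mule0.
rewrite -EFinM; congr EFin.
rewrite -powR_mulrn ?ltW// -powRD; last by rewrite (gt_eqF s0) implybT.
congr (_ `^ _)%R.
by rewrite -[in (_ - n%:R)%R](prednK n0) -natr1; lra.
Qed.

(** Only finiteness is of interest, and it is where [0 < alpha] enters; the punctured
    ball is the increasing union of shells. *)
Lemma integral_punctured_ball_le n (alpha b : R) : (0 < n)%N -> (0 < alpha)%R -> (0 < b)%R ->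
  \int[@lebesgue_rV R n]_(z in [set z | (0 < enorm z < b)%R])
     (enorm z `^ (alpha - n%:R))%:E <= (sphere_area R n * (b `^ alpha / alpha))%:E.
Proof.
move=> n0 al0 b0.
pose F i := [set z : 'rV[R]_n | enorm z \in `[b / i.+1%:R, b[%R].
have bi0 i : (0 < b / i.+1%:R :> R)%R by rewrite divr_gt0.
have -> : [set z : 'rV[R]_n | (0 < enorm z < b)%R] = \bigcup_i F i.
  apply/seteqP; split=> z /=.
    move=> /andP[z0 zb].
    pose j := Num.bound (b / enorm z).
    have jb : (b / enorm z < j%:R)%R by rewrite archi_boundP// divr_ge0// ltW.
    exists j => //; rewrite /F /= in_itv/= zb andbT ler_pdivrMr// mulrC -ler_pdivrMr//.
    by rewrite (le_trans (ltW jb))// ler_nat.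
  by move=> [i _]; rewrite /F/= in_itv/= => /andP[h ->]; rewrite (lt_le_trans (bi0 i)).
have mk D : measurable_fun D (fun z : 'rV[R]_n => (enorm z `^ (alpha - n%:R))%:E).
  apply: measurable_funTS; apply/measurable_EFinP.
  apply: (@measurableT_comp _ _ _ _ _ _ (fun t : mR => (t `^ (alpha - n%:R))%R)).
    exact: measurable_powR.
  exact: measurable_enorm.
have F_nd : nondecreasing_seq F.
  move=> i j ij; apply/subsetPset => z; rewrite /F/= !in_itv/= => /andP[h ->].
  by rewrite andbT (le_trans _ h)// ler_pM2l// lef_pV2 ?posrE// ler_nat.
have mF i : measurable (F i) by exact: measurable_enorm_itv.
have k0 i z : F i z -> 0 <= (enorm z `^ (alpha - n%:R))%:E.
  by move=> _; rewrite lee_fin powR_ge0.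
have H := @ge0_nondecreasing_set_cvg_integral _ _ R F
  (fun z => (enorm z `^ (alpha - n%:R))%:E) (@lebesgue_rV R n) F_nd mF (fun i => mk _) k0.
rewrite -(cvg_lim _ H)//; apply: lime_le; first exact: (cvgP _ H).
near=> i; rewrite integral_shell//; last first.
  by rewrite ler_pdivrMr// ler_peMr ?ler1n// ltW.
rewrite lee_fin ler_wpM2l ?sphere_area_ge0// /powR_prim gt_eqF//.
by rewrite gerBl divr_ge0 ?powR_ge0// ltW.
Unshelve. all: by end_near. Qed.

End sphere.

(** * The potential and the deficit *)

Section kernel.
Context {R : realType} {n : nat} (alpha : R).
Local Notation mu := (@lebesgue_rV R n).
Local Notation mR := (measurableTypeR R).
Implicit Types (x y z : 'rV[R]_n) (A Omega : set 'rV[R]_n).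
Local Open Scope ereal_scope.

Definition riesz_kernel z : \bar R := (enorm z `^ (alpha - n%:R))%:E.

Lemma riesz_kernel_ge0 z : 0 <= riesz_kernel z.
Proof. by rewrite lee_fin powR_ge0. Qed.

Lemma measurable_riesz_kernel A : measurable_fun A riesz_kernel.
Proof.
apply: measurable_funTS; apply/measurable_EFinP.
apply: (@measurableT_comp _ _ _ _ _ _ (fun t : mR => (t `^ (alpha - n%:R))%R)).
  exact: measurable_powR.
exact: measurable_enorm.
Qed.

Lemma measurable_translate x A : measurable A -> measurable [set z | A (x + z)%R].
Proof.
move=> mA; rewrite -[X in measurable X]setTI.
have h := @measurable_affine_rV R n 1 x measurableT A mA.
by congr (measurable _) : h; apply/seteqP; split=> z /=; rewrite scale1r addrC.
Qed.

Lemma riesz_integralE A x : measurable A ->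
  riesz_integral alpha A x = \int[mu]_(z in [set z | A (x + z)%R]) riesz_kernel z.
Proof.
move=> mA; rewrite /riesz_integral integral_mkcond [RHS]integral_mkcond.
rewrite (ge0_integral_translate x); last 2 first.
- apply/(measurable_restrictT _ _).1 => //.
  apply/measurable_EFinP; apply: measurable_funTS.
  rewrite (_ : (fun y => _) = (fun z => enorm z `^ (alpha - n%:R))%R \o
      (fun y => (-1) *: y + x)%R); last first.
    by apply/funext => y /=; rewrite scaleN1r addrC.
  apply: measurableT_comp; last exact: measurable_affine_rV.
  by apply/measurable_EFinP; exact: measurable_riesz_kernel.
- by move=> z; apply: erestrict_ge0 => {}z _; rewrite lee_fin powR_ge0.
apply: eq_integral => z _; rewrite /patch /riesz_kernel.
have -> : ((z + x)%R \in A) = (z \in [set z | A (x + z)%R]).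
  by apply/idP/idP; rewrite !inE/= addrC.
by rewrite opprD addrCA subrr addr0 enormN.
Qed.

(** What the body misses of a ball of radius [D] about [x], weighted by the kernel.
    When [D] exceeds the diameter of [Omega], this is a constant minus the potential,
    but it is nonnegative and needs no renormalization. *)
Definition deficit Omega (D : R) x : \bar R :=
  \int[mu]_(z in [set z | (enorm z < D)%R /\ ~ Omega (x + z)%R]) riesz_kernel z.

Lemma deficit_ge0 Omega D x : 0 <= deficit Omega D x.
Proof. by apply: integral_ge0 => z _; exact: riesz_kernel_ge0. Qed.

Lemma measurable_deficit_set Omega D x : measurable Omega ->
  measurable [set z | (enorm z < D)%R /\ ~ Omega (x + z)%R].
Proof.
move=> mO; rewrite (_ : mkset _ = [set z | enorm z \in `]-oo, D[%R] `&`
    ~` [set z | Omega (x + z)%R]).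
  apply: measurableI; first exact: measurable_enorm_itv.
  by apply: measurableC; exact: measurable_translate.
by apply/seteqP; split=> z /=; rewrite in_itv.
Qed.

Lemma riesz_kernel0 : (alpha < n%:R)%R -> riesz_kernel 0 = 0.
Proof.
move=> an; rewrite /riesz_kernel.
have /eqP -> : enorm (0 : 'rV[R]_n) == 0%R by rewrite enorm_eq0.
by rewrite powR0// subr_eq0 lt_eqF.
Qed.

Lemma counterterm_powR_prim (e : R) : (0 < e)%R -> (alpha <= 0)%R ->
  counterterm n alpha e = (- (sphere_area R n * powR_prim alpha e))%R.
Proof.
move=> e0 a0; rewrite /counterterm /powR_prim; case: eqVneq => [_|an0].
  by rewrite div1r lnV ?posrE// mulrN.
by rewrite powRN div1r invrK invrN mulrN mulNr mulrAC mulrA.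
Qed.

(** For small [e] the shell [e <= |z| < D] is the disjoint union of the part of
    [Omega - x] outside the ball of radius [e] and of the complement of [Omega - x] in
    the ball of radius [D]. Hence the renormalized integral does not depend on [e]. *)
Lemma deficit_interior Omega D x : (0 < n)%N -> (alpha <= 0)%R ->
  closed Omega -> (0 < D)%R -> (forall y, Omega y -> enorm (y - x) < D)%R ->
  interior Omega x ->
  deficit Omega D x \is a fin_num /\
  potential alpha Omega x = (sphere_area R n * powR_prim alpha D)%:E - deficit Omega D x.
Proof.
move=> n0 a0 cO D0 OD Ox.
have mO : measurable Omega by exact: closed_measurable_rV.
have [e0 [e00 e0O]] : exists e0 : R, (0 < e0)%R /\ forall z, (enorm z < e0)%R -> Omega (x + z)%R.
  have /nbhs_ballP[e /= egt0 eO] : nbhs x Omega by exact: Ox.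
  exists e; split=> // z ze; apply: eO; rewrite -ball_normE /ball_/= opprD addrA subrr sub0r normrN.
  exact: le_lt_trans (norm_le_enorm _) ze.
have main e : (0 < e < Num.min e0 D)%R ->
    riesz_integral alpha (Omega `\` eball x e) x + deficit Omega D x =
    (sphere_area R n * (powR_prim alpha D - powR_prim alpha e))%:E.
  rewrite lt_min => /andP[egt0 /andP[ee0 eD]].
  have mB : measurable (Omega `\` eball x e).
    apply: measurableD => //.
    have := measurable_translate (- x)%R _ (measurable_enorm_itv `]-oo, e[%R).
    congr (measurable _); apply/seteqP; split=> z /=; rewrite in_itv/= /eball /=.
      by rewrite (addrC (- x)%R) enormB.
    by rewrite (addrC (- x)%R) enormB.
  rewrite riesz_integralE// -integral_shell//; last exact: ltW.
  rewrite -ge0_integral_setU//.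
  - congr (integral _ _ _); apply/seteqP; split=> z /=.
      case=> [[Oz]|[zD Oz]]; rewrite in_itv/=.
        rewrite /eball/= opprD addrA subrr sub0r enormN => /negP; rewrite -leNgt => ->/=.
        by have := OD _ Oz; rewrite addrAC subrr add0r.
      rewrite zD andbT leNgt; apply/negP => ze; apply: Oz; apply: e0O.
      exact: lt_trans ze ee0.
    rewrite in_itv/= => /andP[ez zD].
    have [Oz|Oz] := pselect (Omega (x + z)%R); [left|by right].
    split=> //; rewrite /eball/= opprD addrA subrr sub0r enormN.
    by apply/negP; rewrite -leNgt.
  - exact: measurable_translate.
  - exact: measurable_deficit_set.
  - exact: measurable_riesz_kernel.
  - by move=> z _; exact: riesz_kernel_ge0.
  - by apply/disj_setPS => z /= [[Oz _] [_ /(_ Oz)]].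
have m0 : (0 < Num.min e0 D)%R by rewrite lt_min e00.
have fd : deficit Omega D x \is a fin_num.
  have m2 : (0 < Num.min e0 D / 2 < Num.min e0 D)%R.
    by rewrite divr_gt0//= ltr_pdivrMr// ltr_pMr// ltr1n.
  have := main _ m2; have := deficit_ge0 Omega D x.
  have : 0 <= riesz_integral alpha (Omega `\` eball x (Num.min e0 D / 2)%R) x.
    by apply: integral_ge0 => z _; rewrite lee_fin powR_ge0.
  by case: (riesz_integral _ _ _) => [?||]//; case: (deficit _ _ _).
split=> //; rewrite /potential a0 /=.
case: asboolP => // _.
apply: (@lim_near_cst _ _ _ _ _ _) => //.
near=> e.
have e_gt0 : (0 < e)%R by near: e; exact: nbhs_right_gt.
have e_lt : (e < Num.min e0 D)%R by near: e; exact: nbhs_right_lt.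
rewrite counterterm_powR_prim//.
have := main e; rewrite e_gt0 e_lt => /(_ isT) /eqP.
rewrite -(fineK fd) eq_sym -sube_eq//; last first.
  by rewrite fin_num_adde_defl.
move=> /eqP <-; rewrite -!EFinB; congr EFin; ring.
Unshelve. all: by end_near. Qed.

(** For [alpha > 0] the kernel is integrable at 0, so that the whole ball of radius
    [D] can be split into its part in [Omega - x] and the rest. *)
Lemma deficit_pos Omega D x : (0 < n)%N -> (0 < alpha)%R -> (alpha < n%:R)%R ->
  closed Omega -> (0 < D)%R -> (forall y, Omega y -> enorm (y - x) < D)%R ->
  deficit Omega D x \is a fin_num /\
  exists2 c : R, c%:E = \int[mu]_(z in [set z | (enorm z < D)%R]) riesz_kernel z &
  potential alpha Omega x = c%:E - deficit Omega D x.
Proof.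
move=> n0 a0 an cO D0 OD.
have mO : measurable Omega by exact: closed_measurable_rV.
set I := \int[mu]_(z in _) _.
have IE : I = \int[mu]_(z in [set z | (0 < enorm z < D)%R]) riesz_kernel z.
  rewrite /I integral_mkcond [RHS]integral_mkcond; apply: eq_integral => z _.
  rewrite /patch.
  have [->|z0] := eqVneq z 0%R; first by rewrite riesz_kernel0//; do 2 case: ifP.
  suff -> : (z \in [set z | (0 < enorm z < D)%R]) = (z \in [set z | (enorm z < D)%R]) by [].
  have := z0; rewrite -enorm_gt0 => ez.
  by apply/idP/idP; rewrite !inE/= ez.
have Ify : I < +oo.
  by rewrite IE (le_lt_trans (integral_punctured_ball_le n alpha D n0 a0 D0))// ltry.
have If : I \is a fin_num.
  by rewrite ge0_fin_numE//; apply: integral_ge0 => z _; exact: riesz_kernel_ge0.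
have key : riesz_integral alpha Omega x + deficit Omega D x = I.
  rewrite riesz_integralE// -ge0_integral_setU//.
  - congr (integral _ _ _); apply/seteqP; split=> z /=.
      case=> [Oz|[]//].
      by have := OD _ Oz; rewrite addrAC subrr add0r.
    by move=> zD; have [Oz|Oz] := pselect (Omega (x + z)%R); [left|right].
  - exact: measurable_translate.
  - exact: measurable_deficit_set.
  - exact: measurable_riesz_kernel.
  - by move=> z _; exact: riesz_kernel_ge0.
  - by apply/disj_setPS => z /= [Oz [_ /(_ Oz)]].
have fd : deficit Omega D x \is a fin_num.
  rewrite ge0_fin_numE ?deficit_ge0//; apply: le_lt_trans Ify.
  rewrite -key leeDr//.
  by apply: integral_ge0 => z _; rewrite lee_fin powR_ge0.
split=> //; exists (fine I); rewrite ?fineK//.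
rewrite /potential leNgt a0/=.
apply/eqP; rewrite eq_sym sube_eq ?fin_num_adde_defl// key//.
Qed.

End kernel.

(** * Minima of lower semicontinuous functions *)

Section minimum.
Context {R : realType} {n : nat}.
Implicit Types (x y z p q u w e : 'rV[R]_n) (C Omega : set 'rV[R]_n).

(** The hypothesis on [f] is sequential lower semicontinuity, restricted to the
    minimising sequences that the argument meets: a cluster point of such a sequence
    is a minimiser. *)
Lemma compact_lsc_min C (f : 'rV[R]_n -> \bar R) : compact C ->
  (forall x, 0 <= f x)%E -> (exists2 q, C q & f q < +oo)%E ->
  (forall (x_ : nat -> 'rV[R]_n) x (a : R), (forall k, C (x_ k)) ->
     x_ @ \oo --> x -> (forall k, f (x_ k) <= (a + k.+1%:R^-1)%:E)%E ->
     (f x <= a%:E)%E) ->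
  exists2 x, C x & forall y, C y -> (f x <= f y)%E.
Proof.
move=> cC f0 [q Cq fq] lsc.
pose m := ereal_inf (f @` C).
have mle y : C y -> (m <= f y)%E by move=> Cy; apply: ereal_inf_lbound; exists y.
have mfin : m \is a fin_num.
  rewrite ge0_fin_numE; first exact: le_lt_trans (mle _ Cq) fq.
  by apply/ereal_infP => _ [y _ <-].
have ex_y k : exists y, C y /\ (f y < (fine m + k.+1%:R^-1)%:E)%E.
  have k0 : 0 < k.+1%:R^-1 :> R by rewrite invr_gt0.
  have [_ [y Cy <-] fy] := lb_ereal_inf_adherent k0 mfin.
  by exists y; split=> //; rewrite EFinD fineK.
have [y_ /all_and2[Cy fy]] := choice ex_y.
have yC : (y_ @ \oo) C by exists 0%N => // k _; exact: Cy.
have [x [Cx clx]] := cC _ (fmap_proper_filter y_ eventually_filter) yC.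
have ex_j k : exists j, (k <= j)%N /\ `|x - y_ j| < k.+1%:R^-1.
  have k0 : 0 < k.+1%:R^-1 :> R by rewrite invr_gt0.
  have h1 : (y_ @ \oo) [set y_ j | j in [set j | (k <= j)%N]].
    by exists k => // j /= kj; exists j.
  have [_ [[j /= kj <-] xj]] := clx _ _ h1 (nbhsx_ballx x _ k0).
  by exists j; split => //; move: xj; rewrite -ball_normE.
have [j_ /all_and2[kj xj]] := choice ex_j.
exists x => // y Cy_; apply: le_trans (mle _ Cy_).
rewrite -(fineK mfin); apply: (lsc (y_ \o j_)) => [k|//|k] /=.
- exact: Cy.
- apply/cvgrPdist_lt => e e0; near=> k.
  apply: lt_trans (xj k) _; near: k; exact: (near_infty_natSinv_lt (PosNum e0)).
- apply: (le_trans (ltW (fy _))); rewrite lee_fin lerD2l.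
  by rewrite lef_pV2 ?posrE// ler_nat ltnS.
Unshelve. all: by end_near. Qed.

End minimum.

(** * Rays and chords of convex bodies *)

Section convexity.
Context {R : realType} {n : nat}.
Implicit Types (x y z p q u w e : 'rV[R]_n) (C Omega : set 'rV[R]_n) (t s : R).

(** The form of [convex_set] in which the weight is a plain real number. *)
Definition segment_closed Omega := forall p q t, Omega p -> Omega q ->
  0 <= t <= 1 -> Omega (t *: p + (1 - t) *: q).

Lemma convex_set_segment Omega : convex_set Omega -> segment_closed Omega.
Proof.
move=> cO p q t Op Oq /andP[t0 t1].
have := cO p q (Itv01 t0 t1); rewrite !inE => /(_ Op Oq).
by [].
Qed.

Lemma ball_translate x (r : R) z : ball x r z <-> `|z - x| < r.
Proof. by rewrite -ball_normE /ball_/= distrC. Qed.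

Lemma interior_ballP Omega x : interior Omega x <->
  exists2 d : R, 0 < d & forall z, `|z| < d -> Omega (x + z).
Proof.
split=> [/nbhs_ballP[d /= d0 dO]|[d d0 dO]].
  exists d => // z zd; apply: dO; apply/ball_translate.
  by rewrite addrAC subrr add0r.
apply/nbhs_ballP; exists d => // z /ball_translate zx.
by rewrite -(subrK x z) addrC; exact: dO.
Qed.

Lemma interior_segment Omega p q t : segment_closed Omega ->
  Omega p -> interior Omega q -> 0 < t <= 1 ->
  interior Omega (t *: q + (1 - t) *: p).
Proof.
move=> cO Op /interior_ballP[d d0 dO] /andP[t0 t1].
apply/interior_ballP; exists (t * d); first by rewrite mulr_gt0.
move=> z zd.
have -> : t *: q + (1 - t) *: p + z = t *: (q + t^-1 *: z) + (1 - t) *: p.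
  by rewrite scalerDr scalerA mulfV ?gt_eqF// scale1r addrAC.
apply: cO => //; last by rewrite ltW.
apply: dO; rewrite normrZ gtr0_norm ?invr_gt0//.
by rewrite mulrC ltr_pdivrMr// mulrC.
Qed.

Lemma interior_midpoint Omega x y : segment_closed Omega ->
  interior Omega x -> interior Omega y -> interior Omega (2^-1 *: (x + y)).
Proof.
move=> cO ix iy.
have -> : 2^-1 *: (x + y) = 2^-1 *: y + (1 - 2^-1) *: x.
  by apply/rowP => i; rewrite !mxE; field.
by apply: interior_segment => //; [exact: interior_subset|lra].
Qed.

(** Along a ray the body is an interval, by convexity, and the interval is closed and
    bounded, by compactness. *)
Lemma ray_exit Omega x u : compact Omega -> segment_closed Omega ->
  interior Omega x -> u != 0 ->
  exists2 r : R, 0 < r & forall s, 0 < s -> Omega (x + s *: u) <-> s <= r.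
Proof.
move=> kO cO /[dup] /interior_subset Ox /interior_ballP[d d0 dO] u0.
pose S := [set s : R | 0 < s /\ Omega (x + s *: u)].
have nu0 : 0 < `|u| by rewrite normr_gt0.
have S0 : S (d / 2 / `|u|).
  split; first by rewrite !divr_gt0.
  apply: dO; rewrite normrZ gtr0_norm ?divr_gt0// divfK ?gt_eqF//.
  by rewrite ltr_pdivrMr// ltr_pMr// ltr1n.
have [M [_ MO]] := compact_bounded kO.
have ubS : has_sup S.
  split; first by exists (d / 2 / `|u|).
  exists ((`|M| + 1 + `|x|) / `|u|) => s [s0 Os].
  rewrite ler_pdivlMr// -[s]gtr0_norm// -normrZ.
  have -> : s *: u = (x + s *: u) - x by rewrite addrAC subrr add0r.
  rewrite (le_trans (ler_normB _ _))// lerD2r.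
  by apply: MO => //; rewrite (le_lt_trans (ler_norm _))// ltrDl.
have r0 : 0 < sup S.
  by rewrite (lt_le_trans S0.1)//; apply: sup_upper_bound.
exists (sup S) => // s s0; split=> [Os|].
  by apply: sup_upper_bound.
have below s' : 0 < s' -> s' < sup S -> Omega (x + s' *: u).
  move=> s'0 /(sup_gt ubS.1)[s1 [s10 Os1] s's1].
  have -> : x + s' *: u = (s' / s1) *: (x + s1 *: u) + (1 - s' / s1) *: x.
    rewrite scalerDr scalerA divfK ?gt_eqF// addrAC -scalerDl.
    by rewrite addrC [1 - _]addrC addrA subrr add0r scale1r addrC.
  apply: cO => //; apply/andP; split; first by rewrite divr_ge0// ltW.
  by rewrite ler_pdivrMr// mul1r ltW.
rewrite le_eqVlt => /predU1P[->|]; last exact: below.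
have clO := compact_closed_rV _ kO.
apply: contrapT => nO.
have : nbhs (x + sup S *: u) (~` Omega).
  by apply: open_nbhs_nbhs; split => //; exact: closed_openC.
move=> /nbhs_ballP[e /= e0 eO].
pose s' := Num.max (sup S / 2) (sup S - e / 2 / `|u|).
have s'0 : 0 < s' by rewrite lt_max divr_gt0.
have s'S : s' < sup S.
  by rewrite gt_max ltr_pdivrMr// ltr_pMr// ltr1n/= gtrBl !divr_gt0.
apply: (eO (x + s' *: u)); last exact: below.
apply/ball_translate; rewrite opprD addrACA subrr add0r -scalerBl normrZ.
rewrite ltr0_norm ?subr_lt0// opprB -ltr_pdivlMr//.
apply: (@le_lt_trans _ _ (e / 2 / `|u|)).
  by rewrite lerBlDr -lerBlDl le_max lexx orbT.
by rewrite ltr_pM2r ?invr_gt0// ltr_pdivrMr// ltr_pMr// ltr1n.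
Qed.

End convexity.

Section strict_chord.
Context {R : realType} {n : nat}.
Implicit Types (x y z p q u w e : 'rV[R]_n) (C Omega : set 'rV[R]_n) (t s : R).

Lemma coord_continuous_rV (i : 'I_n) : continuous (fun z : 'rV[R]_n => z ord0 i).
Proof. by move=> z; exact: coord_continuous. Qed.

Lemma lexicographic_max Omega (f g : 'rV[R]_n -> R) : compact Omega ->
  Omega !=set0 -> continuous f -> continuous g ->
  exists2 w, Omega w & forall z, Omega z -> f z <= f w /\ (f z = f w -> g z <= g w).
Proof.
move=> kO O0 cf cg.
have [w1 w1O w1f] := EVT_max_rV O0 kO (continuous_subspaceT cf).
have clO := compact_closed_rV _ kO.
pose B := Omega `&` (f @^-1` [set t | f w1 <= t]).
have kB : compact B.
  apply: (subclosed_compact _ kO); last by move=> z [].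
  apply: closedI => //; apply: (preimage_closed _ (@closed_ge _ _)) => z _.
  exact: cf.
have B0 : B !=set0 by exists w1; split; [rewrite -inE|rewrite /= lexx].
have [w2 w2B w2g] := EVT_max_rV B0 kB (continuous_subspaceT cg).
move: w2B; rewrite inE => -[Ow2 fw2].
have E : f w2 = f w1.
  by apply/eqP; rewrite eq_le fw2 andbT w1f// inE.
exists w2 => // z Oz; split; first by rewrite E w1f// inE.
by move=> fz; apply: w2g; rewrite inE; split => //=; rewrite fz E.
Qed.

(** If the exit time [rho] of the rays of direction [u] is taken as a function of the
    starting point, the conclusion says that [rho ((x + y) / 2) > (rho x + rho y) / 2],
    in a form that is open in [u]. Take [w] in [Omega - x] that maximizes a linear form
    [l] vanishing on [e = y - x], and that among these maximizers lies furthest in the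
    direction [e]. The ray from [x] in the direction [u = w - e / 2] leaves the body
    at [x + u] at the latest, because [l] does not exceed [l w] there. The ray from [y]
    leaves it before [y + u = x + w + e / 2], which is beyond the extreme point [x + w].
    The midpoint of [x + u] and of this second exit point is then a combination of [x],
    [x + w] and the exit point in which the interior point [x] has positive weight. *)
Lemma strict_chord Omega x y : (2 <= n)%N -> compact Omega -> segment_closed Omega ->
  interior Omega x -> interior Omega y -> x != y ->
  exists u s1 s2, [/\ u != 0, 0 < s1 /\ 0 < s2, ~ Omega (x + s1 *: u),
    ~ Omega (y + s2 *: u) &
    interior Omega (2^-1 *: (x + y) + (2^-1 * (s1 + s2)) *: u)].
Proof.
move=> n2 kO cO ix iy xy.
pose e := y - x.
have e0 : e != 0 by rewrite subr_eq0 eq_sym.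
have [i ei] : exists i, e ord0 i != 0.
  apply: contrapT => /forallNP h; move/eqP: e0; apply; apply/rowP => i.
  by rewrite [RHS]mxE; apply/eqP; apply: contrapT => /negP; exact: h.
(* [l] is a nonzero linear form that vanishes at [e]; this is where the dimension
   has to be at least 2. *)
have [j ji] : exists j : 'I_n, j != i.
  have n0 : (0 < n)%N by rewrite (leq_trans _ n2).
  have [i0|i0] := eqVneq (val i) 0%N.
    by exists (Ordinal n2); rewrite -val_eqE/= i0.
  by exists (Ordinal n0); rewrite -val_eqE/= eq_sym.
pose l z := e ord0 i * z ord0 j - e ord0 j * z ord0 i.
pose g z := e ord0 i * z ord0 i.
have cc (c : R) k : continuous (fun z : 'rV[R]_n => c * z ord0 k).
  move=> z; apply: continuous_comp; last exact: mulrl_continuous.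
  exact: coord_continuous_rV.
have cl : continuous l by move=> z; exact: (continuousB (cc (e ord0 i) j z) (cc (e ord0 j) i z)).
have cg : continuous g by exact: cc.
have lD a b p q : l (a *: p + b *: q) = a * l p + b * l q.
  by rewrite /l !mxE; ring.
have gD a b p q : g (a *: p + b *: q) = a * g p + b * g q.
  by rewrite /g !mxE; ring.
have le0 : l e = 0 by rewrite /l; ring.
have ge0 : 0 < g e by rewrite /g -expr2 exprn_even_gt0.
have Ox : Omega x by exact: interior_subset.
have [w' Ow' w'max] := @lexicographic_max Omega l g kO (ex_intro _ x Ox) cl cg.
pose w := w' - x.
have lw : 0 < l w.
  have /interior_ballP[d d0 dO] := ix.
  pose z : 'rV[R]_n := delta_mx ord0 j.
  pose t := d / 2 / (`|z| + 1) / (`|e ord0 i| + 1).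
  have t0 : 0 < t by rewrite !divr_gt0 // ltr_wpDl.
  have [lz _] : l (x + (t * e ord0 i) *: z) <= l w' /\
      (l (x + (t * e ord0 i) *: z) = l w' -> g (x + (t * e ord0 i) *: z) <= g w').
    apply: w'max; apply: dO; rewrite normrZ normrM gtr0_norm//.
    have a0 : 0 < `|z| + 1 by rewrite ltr_wpDl.
    have b0 : 0 < `|e ord0 i| + 1 by rewrite ltr_wpDl.
    have -> : t * `|e ord0 i| * `|z| =
        d / 2 * (`|z| / (`|z| + 1)) * (`|e ord0 i| / (`|e ord0 i| + 1)).
      rewrite /t; move: a0 b0; move: `|z| `|e ord0 i| => zz ee a0 b0.
      by field; rewrite !gt_eqF.
    have h1 : `|z| / (`|z| + 1) <= 1 by rewrite ler_pdivrMr// mul1r lerDl.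
    have h2 : `|e ord0 i| / (`|e ord0 i| + 1) <= 1 by rewrite ler_pdivrMr// mul1r lerDl.
    apply: (@le_lt_trans _ _ (d / 2)); last by rewrite ltr_pdivrMr// ltr_pMr// ltr1n.
    have h3 : 0 <= d / 2 by rewrite divr_ge0// ltW.
    rewrite -mulrA ler_piMr// -[leRHS]mulr1.
    by apply: ler_pM => //; rewrite divr_ge0// ltW.
  have lwE : l w = l w' - l x by rewrite /l /w !mxE; ring.
  have lxE : l (x + (t * e ord0 i) *: z) = l x + t * e ord0 i ^+ 2.
    rewrite /l /z !mxE !eqxx/= (eq_sym i j) (negbTE ji) /=; ring.
  rewrite lwE subr_gt0 (lt_le_trans _ lz)// lxE ltrDl mulr_gt0// exprn_even_gt0//.
(* Seen from [x], the direction [u] points to the left of [w]; seen from [y], it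
   leaves the body below the level of [w] and to the right of [w]. *)
pose u := w - 2^-1 *: e.
have lu : l u = l w.
  by rewrite /u -[w in l (w - _)]scale1r -scaleNr lD le0 mulr0 addr0 mul1r.
have u0 : u != 0.
  apply: contraTneq lw => uE; rewrite -lu uE /l !mxE !mulr0 subrr ltxx//.
have clO := compact_closed_rV _ kO.
have outx s : 1 < s -> ~ Omega (x + s *: u).
  move=> s1 /w'max[+ _].
  have -> : l (x + s *: u) = l x + s * l u by rewrite -[x in LHS]scale1r lD mul1r.
  rewrite lu (_ : l w' = l x + l w); last by rewrite /l /w !mxE; ring.
  by rewrite lerD2l leNgt ltr_pMl// s1.
have outy : ~ Omega (y + 1 *: u).
  have yE : y + 1 *: u = 1 *: w' + 2^-1 *: e.
    by rewrite /u /w /e !scale1r; apply/rowP => k; rewrite !mxE; field.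
  move=> Oyu; have [_ h] := w'max _ Oyu; move: h.
  rewrite yE lD gD le0 mulr0 addr0 !mul1r => /(_ erefl).
  by rewrite gerDl leNgt => /negP; apply; rewrite mulr_gt0 ?invr_gt0.
have [r r0 rP] := @ray_exit R n Omega y u kO cO iy u0.
have r1 : r < 1.
  by rewrite ltNge; apply/negP => h; apply: outy; apply/rP.
have Oq : Omega (y + r *: u) by apply/rP.
(* The weights that express the midpoint of [x + u] and of the exit point
   [y + r u], relative to [x], through [w] and that exit point; their sum is less
   than 1. *)
pose b := (1 - r) / (4 - 2 * r).
pose a := 2^-1 * (1 + r) - b * r.
have b0 : 0 <= b by rewrite divr_ge0; lra.
have b4 : b <= 4^-1.
  by rewrite /b ler_pdivrMr; lra.
have a0 : 0 < a by rewrite /a; nra.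
have bE : b * (4 - 2 * r) = 1 - r by rewrite /b divfK// gt_eqF//; lra.
have ab1 : a + b < 1 by rewrite /a; nra.
have ab0 : 0 < a + b by lra.
have iM : interior Omega (2^-1 *: (x + y) + (2^-1 * (1 + r)) *: u).
  pose c := (a / (a + b)) *: w' + (1 - a / (a + b)) *: (y + r *: u).
  have Oc : Omega c.
    apply: cO => //; apply/andP; split; first by rewrite divr_ge0// ltW.
    by rewrite ler_pdivrMr// mul1r lerDl.
  have -> : 2^-1 *: (x + y) + (2^-1 * (1 + r)) *: u = (1 - (a + b)) *: x + (1 - (1 - (a + b))) *: c.
    rewrite (_ : 1 - (1 - (a + b)) = a + b); last by ring.
    have -> : (a + b) *: c = a *: w' + b *: (y + r *: u).
      rewrite /c [LHS]scalerDr !scalerA mulrBr mulr1 mulrCA divff ?gt_eqF// mulr1.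
      by rewrite (_ : a + b - a = b)//; ring.
    rewrite /u /w /e; apply/rowP => k; rewrite !mxE /a /b.
    by field; rewrite gt_eqF//; lra.
  apply: interior_segment => //; lra.
have /interior_ballP[d d0 dO] := iM.
have nu0 : 0 < `|u| by rewrite normr_gt0.
pose h := d / 2 / 2 / `|u|.
have h0 : 0 < h by rewrite !divr_gt0.
exists u, (1 + h), (r + h); split.
- exact: u0.
- by split; rewrite addr_gt0.
- by apply: outx; rewrite ltrDl.
- by move=> /rP; rewrite addr_gt0// => /(_ isT); rewrite gerDl leNgt h0.
- apply/interior_ballP; exists (d / 2); first by rewrite divr_gt0.
  move=> z zd.
  rewrite (_ : 2^-1 * (1 + h + (r + h)) = 2^-1 * (1 + r) + h); last by field.
  rewrite scalerDl addrA -[X in Omega X]addrA.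
  apply: dO; rewrite (le_lt_trans (ler_normD _ _))// normrZ gtr0_norm//.
  have -> : h * `|u| = d / 4 by rewrite /h; field; rewrite gt_eqF.
  lra.
Qed.

End strict_chord.

(** * Strict convexity of the deficit *)

Section prim.
Context {R : realType}.
Local Notation lambda := (@lebesgue_measure R).
Implicit Types (alpha r c s : R).

Lemma powR_nincr (p a b : R) : p <= 0 -> 0 < a -> a <= b -> b `^ p <= a `^ p.
Proof.
move=> p0 a0 ab; have b0 := lt_le_trans a0 ab.
rewrite -[p]opprK !(powRN _ (- p)) lef_pV2 ?posrE ?powR_gt0//.
by rewrite ge0_ler_powR ?nnegrE ?oppr_ge0// ltW.
Qed.

(** The derivative [s `^ (alpha - 1)] is nonincreasing, so the primitive is concave
    and lies below its tangents. This is the only use of [alpha <= 1] in the convexity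
    of the deficit. *)
Lemma powR_prim_tangent alpha r c : alpha <= 1 -> 0 < c -> 0 < r ->
  powR_prim alpha r <= powR_prim alpha c + c `^ (alpha - 1) * (r - c).
Proof.
move=> a1 c0 r0.
have p0 : alpha - 1 <= 0 by rewrite subr_le0.
have m x y : measurable_fun (`[x, y]%classic : set (measurableTypeR R))
    (fun s : R => (s `^ (alpha - 1))%:E).
  by apply/measurable_EFinP; apply: measurable_funTS; exact: measurable_powR.
have [cr|rc] := leP c r.
  rewrite -lerBlDl -lee_fin -integral_powR//.
  apply: (@le_trans _ _ (\int[lambda]_(s in `[c, r]) (c `^ (alpha - 1))%:E)%E).
    apply: ge0_le_integral => //.
    - by move=> s _; rewrite lee_fin powR_ge0.
    - move=> s /=; rewrite in_itv/= => /andP[cs _].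
      by rewrite lee_fin powR_nincr.
  rewrite integral_cst//= lebesgue_measure_itv/= lte_fin; case: ifPn => h.
    by rewrite -EFinB -EFinM.
  by rewrite mule0 lee_fin mulr_ge0 ?powR_ge0// subr_ge0.
have cr := ltW rc.
rewrite -lerBlDl -opprB -(opprB c r) mulrN lerN2 -lee_fin -integral_powR//.
apply: (@le_trans _ _ (\int[lambda]_(s in `[r, c]) (c `^ (alpha - 1))%:E)%E).
  by rewrite integral_cst//= lebesgue_measure_itv/= lte_fin rc -EFinB -EFinM.
apply: ge0_le_integral => //.
- by move=> s _; rewrite lee_fin powR_ge0.
- move=> s /=; rewrite in_itv/= => /andP[rs sc].
  by rewrite lee_fin powR_nincr// (lt_le_trans r0).
Qed.

Lemma powR_prim_mid alpha r1 r2 c : alpha <= 1 -> 0 < c -> 0 < r1 -> 0 < r2 ->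
  r1 + r2 <= 2 * c ->
  powR_prim alpha r1 + powR_prim alpha r2 <= 2 * powR_prim alpha c.
Proof.
move=> a1 c0 r10 r20 rc.
have h1 := powR_prim_tangent _ _ _ a1 c0 r10.
have h2 := powR_prim_tangent _ _ _ a1 c0 r20.
have pc : 0 <= c `^ (alpha - 1) by exact: powR_ge0.
nra.
Qed.

Lemma powR_prim_mid_lt alpha r1 r2 c : alpha <= 1 -> 0 < c -> 0 < r1 -> 0 < r2 ->
  r1 + r2 < 2 * c ->
  powR_prim alpha r1 + powR_prim alpha r2 < 2 * powR_prim alpha c.
Proof.
move=> a1 c0 r10 r20 rc.
have h1 := powR_prim_tangent _ _ _ a1 c0 r10.
have h2 := powR_prim_tangent _ _ _ a1 c0 r20.
have pc : 0 < c `^ (alpha - 1) by exact: powR_gt0.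
nra.
Qed.
End prim.

(** If the integrals were equal, the nonnegative function [g - f] would vanish almost
    everywhere. *)
Lemma ge0_lt_integral d (T : measurableType d) (R : realType)
    (mu : {measure set T -> \bar R}) (A B : set T) (f g : T -> \bar R) :
  measurable A -> measurable B -> B `<=` A -> (0 < mu B)%E ->
  measurable_fun A f -> measurable_fun A g ->
  (forall x, A x -> 0 <= f x)%E -> (forall x, A x -> f x \is a fin_num) ->
  (forall x, A x -> f x <= g x)%E ->
  (forall x, B x -> f x < g x)%E -> (\int[mu]_(x in A) f x < +oo)%E ->
  (\int[mu]_(x in A) f x < \int[mu]_(x in A) g x)%E.
Proof.
move=> mA mB BA B0 mf mg f0 ffin fg fgB fy.
rewrite lt_neqAle ge0_le_integral// andbT; apply/negP => /eqP E.
pose h x := (g x - f x)%E.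
have h0 x : A x -> (0 <= h x)%E by move=> Ax; rewrite sube_ge0 ?fg ?ffin.
have mh : measurable_fun A h by exact: emeasurable_funB.
have hE : (\int[mu]_(x in A) g x = \int[mu]_(x in A) f x + \int[mu]_(x in A) h x)%E.
  rewrite -ge0_integralD//; apply: eq_integral => x; rewrite inE => Ax.
  by rewrite addeC /h subeK// ffin.
have Ih0 : (\int[mu]_(x in A) `|h x| = 0)%E.
  under eq_integral => x /[!inE] Ax do rewrite gee0_abs ?h0//.
  have fn : (\int[mu]_(x in A) f x)%E \is a fin_num.
    by rewrite ge0_fin_numE// integral_ge0.
  by move: hE; rewrite -E => /eqP; rewrite addeC -sube_eq ?subee// ?fin_num_adde_defl// => /eqP <-.
have [N [mN muN0 subN]] := (ae_eq_integral_abs mu mA mh).1 Ih0.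
move: B0; rewrite lt0e => /andP[/negP + _]; apply.
rewrite eq_le measure_ge0 andbT -muN0 le_measure ?inE// => x Bx.
apply: subN => /= /(_ (BA _ Bx)) hx.
by have := fgB _ Bx; rewrite -sube_gt0 -/(h x) hx ltxx.
Qed.

Section deficit_rays.
Context {R : realType} {n : nat}.
Local Notation lambda := (@lebesgue_measure R).
Local Notation mu := (@lebesgue_rV R n).
Local Notation mR := (measurableTypeR R).
Implicit Types (x y z u : 'rV[R]_n) (s : R) (K : 'rV[R]_n -> \bar R) (Omega : set 'rV[R]_n).
Local Open Scope ereal_scope.

Definition deficit_kernel alpha Omega D x : 'rV[R]_n -> \bar R :=
  riesz_kernel alpha \_ [set z | (enorm z < D)%R /\ ~ Omega (x + z)%R].

Lemma deficit_kernel_ge0 alpha Omega D x z : 0 <= deficit_kernel alpha Omega D x z.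
Proof. by apply: erestrict_ge0 => {}z _; exact: riesz_kernel_ge0. Qed.

Lemma measurable_deficit_kernel alpha Omega D x : closed Omega ->
  measurable_fun setT (deficit_kernel alpha Omega D x).
Proof.
move=> cO; apply/(measurable_restrictT _ _).1; last exact: measurable_riesz_kernel.
by apply: measurable_deficit_set; exact: closed_measurable_rV.
Qed.

(** A ray from [x] misses the body exactly between its exit time [r] and the time at
    which it leaves the ball of radius [D]. *)
Lemma ray_integral_deficit alpha Omega D x u r : (0 < n)%N -> u != 0%R ->
  (0 < r)%R -> (r * enorm u < D)%R ->
  (forall s, (0 < s)%R -> Omega (x + s *: u)%R <-> (s <= r)%R) ->
  ray_integral (deficit_kernel alpha Omega D x) u =
  (enorm u `^ (alpha - n%:R) * (powR_prim alpha (D / enorm u) - powR_prim alpha r))%:E.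
Proof.
move=> n0 u0 r0 rD rP.
have nu0 : (0 < enorm u)%R by rewrite enorm_gt0.
have rL : (r <= D / enorm u)%R by rewrite ler_pdivlMr// ltW.
have mp A : measurable_fun (A : set mR) (fun s : R => (s `^ (alpha - 1))%:E).
  by apply/measurable_EFinP; apply: measurable_funTS; exact: measurable_powR.
rewrite [RHS]EFinM -integral_powR// integral_itv_bndoo; last exact: mp.
rewrite -[RHS]ge0_integralZl//; last 2 first.
- by move=> s _; rewrite lee_fin powR_ge0.
- by rewrite lee_fin powR_ge0.
rewrite /ray_integral [LHS]integral_mkcond [RHS]integral_mkcond.
apply: eq_integral => s _.
rewrite /patch !mem_setE !in_itv/= andbT.
have [s0|s0] := ltP 0%R s; last by rewrite ltNge (le_trans s0 (ltW r0)).
rewrite /deficit_kernel /patch.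
have -> : ((s *: u)%R \in [set z | (enorm z < D)%R /\ ~ Omega (x + z)%R]) = (r < s < D / enorm u)%R.
  apply/idP/idP; rewrite inE/= enormZ gtr0_norm// ltr_pdivlMr//.
    by move=> [-> h]; rewrite andbT ltNge; apply/negP => sr; apply: h; apply/rP.
  by move=> /andP[rs ->]; split=> // /rP - /(_ s0); rewrite leNgt rs.
case: ifP => _; last by rewrite mule0.
rewrite /riesz_kernel enormZ gtr0_norm// powRM ?ltW//.
rewrite -!EFinM; congr EFin; rewrite mulrA mulrC; congr (_ * _)%R.
rewrite -powR_mulrn ?ltW// -powRD; last by rewrite (gt_eqF s0) implybT.
by congr (_ `^ _)%R; rewrite -[in (_ - n%:R)%R](prednK n0) -natr1; lra.
Qed.

Lemma deficitE alpha Omega D x : (0 < n)%N -> closed Omega ->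
  deficit alpha Omega D x =
  \int[mu]_(u in annulus) ray_integral (deficit_kernel alpha Omega D x) u.
Proof.
move=> n0 cO; rewrite -polar//; last 2 first.
- exact: measurable_deficit_kernel.
- exact: deficit_kernel_ge0.
by rewrite /deficit integral_mkcond.
Qed.

(** Direction by direction the deficit is a decreasing convex function of the exit
    time (by [powR_prim_mid]), and the exit time is a concave function of the starting
    point. For [alpha = 1] the former is affine, so that strictness has to come from the
    latter: [strict_chord] provides one direction, hence a nonempty open set of them. *)
Lemma deficit_strict alpha Omega D x y : (2 <= n)%N -> (alpha <= 1)%R ->
  compact Omega -> segment_closed Omega ->
  (forall p q, Omega p -> Omega q -> enorm (q - p) < D)%R ->
  interior Omega x -> interior Omega y -> x != y ->
  deficit alpha Omega D (2^-1 *: (x + y))%R < +oo ->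
  2%:E * deficit alpha Omega D (2^-1 *: (x + y))%R <
  deficit alpha Omega D x + deficit alpha Omega D y.
Proof.
move=> n2 a1 kO cO OD ix iy xy fm.
have n0 : (0 < n)%N by rewrite (leq_trans _ n2).
have clO := compact_closed_rV _ kO.
set m := (2^-1 *: (x + y))%R.
have mE : m = (2^-1 *: y + (1 - 2^-1) *: x)%R.
  rewrite /m scalerDr addrC (_ : 1 - 2^-1 = 2^-1)%R//; by lra.
have im : interior Omega m by exact: interior_midpoint.
have ex p : interior Omega p -> forall u, u != 0%R -> exists2 r, (0 < r)%R &
    (r * enorm u < D)%R /\ forall s, (0 < s)%R -> Omega (p + s *: u)%R <-> (s <= r)%R.
  move=> ip u u0; have [r r0 rP] := ray_exit _ _ _ kO cO ip u0.
  exists r => //; split => //.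
  have Or : Omega (p + r *: u)%R by apply/(rP _ r0).
  have := OD p (p + r *: u)%R (interior_subset ip) Or.
  by rewrite addrAC subrr add0r enormZ gtr0_norm.
have annu0 u : annulus u -> u != 0%R.
  by move=> /andP[u1 _]; rewrite -enorm_gt0 (lt_trans _ u1).
pose J p u := ray_integral (deficit_kernel alpha Omega D p) u.
have mJ p A : measurable_fun A (J p).
  apply: measurable_funTS; apply: measurable_ray_integral.
    exact: measurable_deficit_kernel.
  exact: deficit_kernel_ge0.
have J0 p u : 0 <= J p u.
  apply: integral_ge0 => s /=; rewrite in_itv/= andbT => s0.
  by rewrite mule_ge0 ?deficit_kernel_ge0// lee_fin exprn_ge0// ltW.
have mA := @measurable_annulus R n.
rewrite !deficitE// -ge0_integralZl//; [|exact: mJ|by move=> u _; exact: J0].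
rewrite -ge0_integralD//; [|by move=> u _; exact: J0|exact: mJ|by move=> u _; exact: J0|exact: mJ].
have [u1 [s1 [s2 [u10 [s10 s20] Ox Oy Om]]]] := strict_chord _ _ _ n2 kO cO ix iy xy.
have nu10 : (0 < enorm u1)%R by rewrite enorm_gt0.
(* Only directions of the annulus are integrated over, and 1 < 2 < e. *)
pose k := (2 / enorm u1)%R.
have k0 : (0 < k)%R by rewrite divr_gt0.
pose u2 := (k *: u1)%R.
pose t1 := (s1 / k)%R; pose t2 := (s2 / k)%R.
have t10 : (0 < t1)%R by rewrite divr_gt0.
have t20 : (0 < t2)%R by rewrite divr_gt0.
have ca p t : continuous (fun u : 'rV[R]_n => p + t *: u)%R.
  move=> u; apply: (@continuousD _ _ _ (fun=> p) (fun u => t *: u)%R).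
    exact: cst_continuous.
  exact: scaler_continuous.
pose B := annulus `&` ((fun u => x + t1 *: u)%R @^-1` (~` Omega) `&`
  ((fun u => y + t2 *: u)%R @^-1` (~` Omega) `&`
   (fun u => m + (2^-1 * (t1 + t2)) *: u)%R @^-1` (interior Omega))).
have oB : open B.
  apply: openI.
    rewrite (_ : annulus = @enorm R n @^-1` `]1%R, expR 1%R[%classic).
      by apply: open_comp; [move=> u _; exact: enorm_continuous|exact: interval_open].
    by apply/seteqP; split=> u /=; rewrite in_itv.
  apply: openI; first by apply: open_comp => [u _|]; [exact: ca|exact: closed_openC].
  apply: openI; first by apply: open_comp => [u _|]; [exact: ca|exact: closed_openC].
  by apply: open_comp => [u _|]; [exact: ca|exact: open_interior].
have Bu2 : B u2.
  have E t : ((t / k) *: u2 = t *: u1)%R by rewrite /u2 scalerA divfK// gt_eqF.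
  split; [|split; [|split]] => /=.
  - rewrite /annulus/= /u2 enormZ gtr0_norm// /k divfK ?gt_eqF// ltr1n/=.
    by have := @expR_gt1Dx R 1; rewrite oner_eq0 -natr1 addrC; apply.
  - by rewrite E.
  - by rewrite E.
  - by rewrite /t1 /t2 -mulrDl mulrA E.
have muB : 0 < mu B by apply: mu_open_gt0 => //; exists u2.
(* Concavity of the exit time in the base point gives the weak inequality for
   every direction; in the directions of [B] the exit times from [x] and [y] are
   below [t1] and [t2], the one from [m] is not below their mean. *)
have cmp u : annulus u -> exists a b c : R, [/\ J x u = a%:E, J y u = b%:E,
    J m u = c%:E, (2 * c <= a + b)%R & (B u -> 2 * c < a + b)%R].
  move=> /annu0 u0.
  have [r1 r10 [r1D r1P]] := ex x ix u u0.
  have [r2 r20 [r2D r2P]] := ex y iy u u0.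
  have [c c0 [cD cP]] := ex m im u u0.
  have w0 : (0 < enorm u `^ (alpha - n%:R))%R by rewrite powR_gt0// enorm_gt0.
  set w := (enorm u `^ (alpha - n%:R))%R in w0.
  set L := powR_prim alpha (D / enorm u).
  exists (w * (L - powR_prim alpha r1))%R, (w * (L - powR_prim alpha r2))%R,
    (w * (L - powR_prim alpha c))%R; split.
  - exact: ray_integral_deficit.
  - exact: ray_integral_deficit.
  - exact: ray_integral_deficit.
  - have r12 : (r1 + r2 <= 2 * c)%R.
      have : (2^-1 * (r1 + r2) <= c)%R.
        apply/cP; first by rewrite mulr_gt0// addr_gt0.
        have -> : (m + (2^-1 * (r1 + r2)) *: u =
            2^-1 *: (y + r2 *: u) + (1 - 2^-1) *: (x + r1 *: u))%R.
          by rewrite mE; apply/rowP => i; rewrite !mxE; field.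
        apply: cO; [exact/r2P|exact/r1P|lra].
      by lra.
    have := powR_prim_mid _ _ _ _ a1 c0 r10 r20 r12; nra.
  - move=> [_ [Bx [By Bm]]].
    have r12 : (r1 + r2 < 2 * c)%R.
      have h1 : (r1 < t1)%R by rewrite ltNge; apply/negP => h; apply: Bx; apply/r1P.
      have h2 : (r2 < t2)%R by rewrite ltNge; apply/negP => h; apply: By; apply/r2P.
      have : (2^-1 * (t1 + t2) <= c)%R.
        apply/cP; first by rewrite mulr_gt0// addr_gt0.
        exact: interior_subset Bm.
      by lra.
    have := powR_prim_mid_lt _ _ _ _ a1 c0 r10 r20 r12; nra.
rewrite /J in cmp.
apply: (@ge0_lt_integral _ _ _ _ _ B) => //.
- exact: open_measurable_rV.
- by move=> u [].
- by apply: emeasurable_funM => //; exact: mJ.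
- by apply: emeasurable_funD; exact: mJ.
- by move=> u _; apply: mule_ge0 => //; exact: J0.
- by move=> u /cmp[a [b [c [_ _ -> _ _]]]].
- by move=> u /cmp[a [b [c [-> -> -> h _]]]]; rewrite -EFinM -EFinD lee_fin.
- move=> u Bu; have [a [b [c [-> -> -> _ h]]]] := cmp u Bu.1.
  by rewrite -EFinM -EFinD lte_fin; exact: h.
- rewrite ge0_integralZl//; [|exact: mJ|by move=> u _; exact: J0].
  by rewrite -deficitE// lte_mul_pinfty.
Qed.

End deficit_rays.

(** * The deficit near a boundary point *)

Section real_lemmas.
Context {R : realType}.

Lemma bernoulli_inequality (t : R) k : 0 <= t <= 1 -> 1 - k%:R * t <= (1 - t) ^+ k.
Proof.
move=> /andP[t0 t1]; elim: k => [|k IH]; first by rewrite mul0r subr0 expr0.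
have h : 0 <= (1 - t) by rewrite subr_ge0.
have hk : 0 <= k%:R * t by rewrite mulr_ge0.
rewrite exprS -natr1; nra.
Qed.

Lemma geometric_le (a : R) k : 2 <= a -> \sum_(i < k.+1) a ^+ i <= 2 * a ^+ k.
Proof.
move=> a2; elim: k => [|k IH].
  by rewrite big_ord_recl big_ord0 expr0 addr0 mulr1 ler1n.
rewrite big_ord_recr/=.
have h : 0 <= a ^+ k by rewrite exprn_ge0//; lra.
by rewrite [in leRHS]exprS exprS; nra.
Qed.

(** The terms with [2 ^ k <= 1 / b] form a geometric sum of ratio at least 2, hence at
    most twice its last term; the factor [1 / 2] compensates for this. *)
Lemma dyadic_layers (m K : nat) (b : R) : (0 < m)%N -> 0 < b ->
  \sum_(k < K) 2^-1 * (2 ^+ m) ^+ k * (b * 2 ^+ k <= 1)%R%:R <= b ^- m.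
Proof.
move=> m0 b0; have bm : 0 < b ^- m by rewrite invr_gt0 exprn_gt0.
elim: K => [|K IH]; first by rewrite big_ord0 ltW.
rewrite big_ord_recr/=; case: (boolP (b * 2 ^+ K <= 1)) => [bK|_]; last first.
  by rewrite mulr0 addr0.
have a2 : 2 <= 2 ^+ m :> R.
  by rewrite -[leLHS]expr1 ler_weXn2l// ?ler1n.
apply: (@le_trans _ _ ((2 ^+ m) ^+ K)); last first.
  rewrite -exprM mulnC exprM -exprVn; apply: lerXn2r; rewrite ?nnegrE ?exprn_ge0//.
    by rewrite invr_ge0 ltW.
  by rewrite -div1r ler_pdivlMr// mulrC.
apply: (@le_trans _ _ (2^-1 * \sum_(i < K.+1) (2 ^+ m) ^+ i)).
  rewrite mulr_sumr big_ord_recr/= mulr1 lerD2r; apply: ler_sum => k _.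
  by rewrite ler_piMr ?lern1 ?leq_b1// mulr_ge0// exprn_ge0// exprn_ge0.
by have := geometric_le _ K a2; lra.
Qed.

End real_lemmas.

Section exchange.
Context {R : realType} {n : nat}.
Local Notation mu := (@lebesgue_rV R n).
Implicit Types (x y z p q d w : 'rV[R]_n) (Omega : set 'rV[R]_n).
Local Open Scope ereal_scope.

(** Both sides integrate over the [z] for which [p + z] or [p + v + z] is outside
    [Omega]. *)
Lemma deficit_exchange alpha Omega D p v : measurable Omega ->
  deficit alpha Omega D (p + v)%R +
    \int[mu]_(z in [set z | (enorm z < D)%R /\ (~ Omega (p + z)%R /\ Omega (p + v + z)%R)])
      riesz_kernel alpha z =
  deficit alpha Omega D p +
    \int[mu]_(z in [set z | (enorm z < D)%R /\ (Omega (p + z)%R /\ ~ Omega (p + v + z)%R)])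
      riesz_kernel alpha z.
Proof.
move=> mO.
have mB := @measurable_enorm_lt R n D.
have m1 := measurable_translate p _ mO.
have m2 := measurable_translate (p + v)%R _ mO.
rewrite /deficit -!ge0_integral_setU//.
- congr (integral _ _ _); apply/seteqP; split => z /=.
    case=> [[zD h2]|[zD [h1 h2]]].
      by have [h1|h1] := pselect (Omega (p + z)%R); [right|left].
    by left.
  case=> [[zD h1]|[zD [h1 h2]]].
    by have [h2|h2] := pselect (Omega (p + v + z)%R); [right|left].
  by left.
- by apply: measurableI => //; exact: measurableC.
- by apply: measurableI => //; apply: measurableI => //; exact: measurableC.
- exact: measurable_riesz_kernel.
- by move=> z _; exact: riesz_kernel_ge0.
- by apply/disj_setPS => z /= [[_ h] [_ [h' _]]].
- by apply: measurableI => //; exact: measurableC.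
- by apply: measurableI => //; apply: measurableI => //; exact: measurableC.
- exact: measurable_riesz_kernel.
- by move=> z _; exact: riesz_kernel_ge0.
- by apply/disj_setPS => z /= [[_ h] [_ [_ h']]].
Qed.

(** A point [z] that leaves [Omega - p] under the shift by [t d] is not near 0, by
    convexity, so the kernel is bounded there. The set of such [z] has measure at most
    [(1 - (1 - t) ^ n) mu Omega], because [(1 - t) (Omega - p)] stays inside. *)
Lemma loss_bound alpha Omega D p d (delta t : R) : (alpha <= 1)%R -> (2 <= n)%N ->
  compact Omega -> segment_closed Omega -> Omega p -> (0 < delta)%R ->
  (forall w, `|w| < delta -> Omega (p + d + w))%R -> (0 <= t < 1)%R ->
  \int[mu]_(z in [set z | (enorm z < D)%R /\ (Omega (p + z)%R /\ ~ Omega (p + t *: d + z)%R)])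
      riesz_kernel alpha z <=
  (delta `^ (alpha - n%:R) * (n%:R * t * fine (mu Omega)))%:E.
Proof.
move=> a1 n2 kO cO Op d0 dO /andP[t0 t1].
have clO := compact_closed_rV _ kO.
have mO := closed_measurable_rV _ clO.
have muO : mu Omega < +oo by apply: mu_bounded_lty => //; exact: compact_bounded.
have muOf : mu Omega \is a fin_num by rewrite ge0_fin_numE.
have mB := @measurable_enorm_lt R n D.
have m1 := measurable_translate p _ mO.
have m2 := measurable_translate (p + t *: d)%R _ mO.
have m12 := measurableI _ _ m1 (measurableC m2).
pose L := [set z | Omega (p + z)%R /\ ~ Omega (p + t *: d + z)%R].
have mL : measurable L by exact: m12.
pose C := [set z | Omega (p + z)%R].
have muC : mu C = mu Omega.
  rewrite [RHS](mu_translate p)// /C; congr (mu _).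
  by apply/seteqP; split => z /=; rewrite addrC.
(* [(1 - t) C] lies in [C] and misses [L]; it has measure [(1 - t) ^ n mu C]. *)
have muL : mu L <= (n%:R * t * fine (mu Omega))%:E.
  have s0 : (0 < (1 - t)^-1)%R by rewrite invr_gt0 subr_gt0.
  pose C' := [set z | C ((1 - t)^-1 *: z + 0)%R].
  have mC' : measurable C'.
    by rewrite -[C']setTI; exact: (measurable_affine_rV n _ _ measurableT C m1).
  have CE := mu_affine _ 0%R _ s0 m1.
  have u0 : (0 < 1 - t)%R by rewrite subr_gt0.
  have sub : C' `|` L `<=` C.
    move=> z [|[]//]; rewrite /C' /C /= addr0 => Oz.
    have -> : (p + z = (1 - t) *: (p + (1 - t)^-1 *: z) + (1 - (1 - t)) *: p)%R.
      rewrite scalerDr scalerA mulfV ?gt_eqF// scale1r addrAC -scalerDl.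
      by rewrite addrC subrKC scale1r addrC.
    by apply: cO => //; lra.
  have disj : [disjoint C' & L].
    apply/disj_setPS => z [+ [_]] /=; rewrite /C' /C /= addr0 => Oz; apply.
    have -> : (p + t *: d + z = (1 - t) *: (p + (1 - t)^-1 *: z) + (1 - (1 - t)) *: (p + d + 0))%R.
      rewrite !scalerDr scalerA mulfV ?gt_eqF// scale1r scaler0 addr0.
      by apply/rowP => i; rewrite !mxE; ring.
    apply: cO => //; last lra.
    by apply: dO; rewrite normr0.
  have le1 : mu C' + mu L <= mu C.
    rewrite -measureU//; last by apply/eqP; rewrite -disj_set2E.
    by apply: le_measure => //; rewrite inE//; exact: measurableU.
  have C'0 : 0 <= mu C' by exact: measure_ge0.
  have L0 : 0 <= mu L by exact: measure_ge0.
  move: CE le1; rewrite -/C -/C' muC; move: muOf C'0 L0.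
  case: (mu Omega) => [M| |]// _; case: (mu C') => [c| |]//; last first.
    by rewrite gt0_muley ?lte_fin ?exprn_gt0.
  case: (mu L) => [l| |]//; rewrite !lee_fin /= => c0 l0 [ME] cl.
  have cE : c = ((1 - t) ^+ n * M)%R.
    by rewrite ME mulrA -exprMn mulfV ?gt_eqF// expr1n mul1r.
  have M0 : (0 <= M)%R by rewrite (le_trans _ cl)// addr_ge0.
  have t01 : (0 <= t <= 1)%R by rewrite t0 ltW.
  by have := bernoulli_inequality t n t01; nra.
apply: (@le_trans _ _ (\int[mu]_(z in L) (delta `^ (alpha - n%:R))%:E)).
  apply: (@le_trans _ _ (\int[mu]_(z in [set z | (enorm z < D)%R /\ L z])
      (delta `^ (alpha - n%:R))%:E)).
    apply: ge0_le_integral => //.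
    - exact: measurableI.
    - by move=> z _; exact: riesz_kernel_ge0.
    - exact: measurable_riesz_kernel.
    - move=> z [zD [Oz nOz]]; rewrite lee_fin; apply: powR_nincr => //.
        by rewrite subr_le0 (le_trans a1)// ler1n (leq_trans _ n2).
      rewrite leNgt; apply/negP => zd; apply: nOz.
      have -> : (p + t *: d + z = t *: (p + d + z) + (1 - t) *: (p + z))%R.
        by apply/rowP => i; rewrite !mxE; ring.
      apply: cO => //; last by rewrite t0 ltW.
      by apply: dO; rewrite (le_lt_trans (norm_le_enorm z)).
  apply: ge0_subset_integral => //.
  - exact: measurableI.
  - by move=> z _; rewrite lee_fin powR_ge0.
  - by move=> z [].
by rewrite integral_cst// EFinM lee_wpmul2l// lee_fin powR_ge0.
Qed.

End exchange.

Section gain.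
Context {R : realType} {n : nat}.
Local Notation mu := (@lebesgue_rV R n).
Implicit Types (x y z p q d w : 'rV[R]_n) (Omega : set 'rV[R]_n).
Local Open Scope ereal_scope.

(** The points that join [Omega - p] when the base point moves from [p] to [p + t d]. *)
Definition entered Omega p d (t : R) :=
  [set z | ~ Omega (p + z)%R /\ Omega (p + t *: d + z)%R].

Lemma measurable_entered Omega p d t : measurable Omega ->
  measurable (entered Omega p d t).
Proof.
move=> mO; apply: measurableI; last exact: measurable_translate.
by apply: measurableC; exact: measurable_translate.
Qed.

(** At every scale [r >= t] a share of order [t r ^ (n - 1)] of the ball of radius [r]
    is entered. There is a ball [Z] of radius comparable with [r], near [- r eps d],
    that lies outside [Omega - p], since [p] is not interior, and is carried into it by
    the shift [r d]. Split this shift into [N] equal steps: by translation invariance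
    the [N] sets of points that enter at a given step together cover [Z], and each has
    at most the measure of the set entered in one step. *)
Lemma entered_measure Omega p d (delta eps r : R) (N : nat) :
  compact Omega -> segment_closed Omega -> Omega p -> ~ interior Omega p ->
  (0 < delta)%R -> (forall w, `|w| < delta -> Omega (p + d + w))%R ->
  (0 < eps <= 1)%R -> (eps * (delta + `|d|) < delta)%R ->
  (0 < r <= 1)%R -> (0 < N)%N ->
  ((2 * (r * (eps * delta))) ^+ n)%:E <= N%:R%:E *
    mu (entered Omega p d (r / N%:R) `&`
        [set z | (enorm z <= n%:R * (delta + `|d|) * r)%R]).
Proof.
move=> kO cO Op nip d0 dO /andP[e0 e1] ed /andP[r0 r1] N0.
have clO := compact_closed_rV _ kO.
have mO := closed_measurable_rV _ clO.
set t := (r / N%:R)%R.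
have tN : (t * N%:R = r)%R by rewrite /t divfK// pnatr_eq0 -lt0n.
have N0R : (0 < N%:R :> R)%R by rewrite ltr0n.
have t0 : (0 < t)%R by rewrite divr_gt0.
set A := _ `&` _.
have mA : measurable A.
  apply: measurableI; first exact: measurable_entered.
  have := @measurable_enorm_itv R n `]-oo, (n%:R * (delta + `|d|) * r)%R].
  by congr (measurable _); apply/seteqP; split => z /=; rewrite in_itv.
pose Z := ball (- (r * eps) *: d)%R (r * (eps * delta))%R : set 'rV[R]_n.
have mZ : measurable Z by apply: open_measurable_rV; exact: ball_open.
rewrite -(mu_ball (- (r * eps) *: d)%R) ?mulr_gt0// -/Z.
have re0 : (0 < r * eps)%R by rewrite mulr_gt0.
have Zw z : Z z -> exists2 w, (`|w| < delta)%R & z = ((r * eps) *: (w - d))%R.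
  move=> /ball_translate; rewrite scaleNr opprK => zd.
  exists ((r * eps)^-1 *: z + d)%R.
    have -> : ((r * eps)^-1 *: z + d = (r * eps)^-1 *: (z + (r * eps) *: d))%R.
      by rewrite scalerDr scalerA mulVf ?scale1r// gt_eqF.
    by rewrite normrZ gtr0_norm ?invr_gt0// mulrC ltr_pdivrMr//
      (_ : delta * (r * eps) = r * (eps * delta))%R//; ring.
  by rewrite addrK scalerA mulfV ?scale1r// gt_eqF.
have Zout z : Z z -> ~ Omega (p + z)%R.
  move=> /Zw[w wd ->] Oz; apply: nip.
  have iq : interior Omega (p + d - w)%R.
    apply/interior_ballP; exists (delta - `|w|)%R; first by rewrite subr_gt0.
    move=> v vd; rewrite -addrA; apply: dO.
    rewrite (le_lt_trans (ler_normD _ _))// normrN; lra.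
  have rei : (0 < r * eps <= 1)%R by rewrite re0/= mulr_ile1// ltW.
  have := interior_segment _ _ _ _ cO Op iq rei => h1.
  have h2 := interior_segment _ _ _ (2^-1)%R cO Oz h1.
  have -> : p = (2^-1 *: ((r * eps) *: (p + d - w) + (1 - r * eps) *: p) +
      (1 - 2^-1) *: (p + (r * eps) *: (w - d)))%R.
    by apply/rowP => i; rewrite !mxE; field.
  by apply: h2; lra.
have Zin z : Z z -> Omega (p + r *: d + z)%R.
  move=> /Zw[w wd ->].
  have -> : (p + r *: d + (r * eps) *: (w - d) = r *: (p + d + eps *: (w - d)) + (1 - r) *: p)%R.
    by apply/rowP => i; rewrite !mxE; ring.
  apply: cO => //; last by rewrite r1 ltW.
  apply: dO; apply: le_lt_trans ed; rewrite normrZ gtr0_norm// ler_pM2l//.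
  by rewrite (le_trans (ler_normB _ _))// lerD2r ltW.
(* On its way from [z] to [z + r d], by steps of [t d], a point of [Z] enters
   [Omega - p] at some step [j < N]. *)
pose A_ (j : nat) := [set z | A (z + (j%:R * t) *: d)%R].
have mA_ j : measurable (A_ j).
  have := measurable_translate ((j%:R * t) *: d)%R _ mA.
  by congr (measurable _); apply/seteqP; split => z /=; rewrite /A_/= addrC.
have ZA : Z `<=` \big[setU/set0]_(j < N) A_ j.
  move=> z Zz; rewrite -bigcup_mkord.
  pose P j := `[< Omega (p + (j%:R * t) *: d + z)%R >].
  have exP : exists j, P j.
    by exists N; apply/asboolP; rewrite mulrC tN; exact: Zin.
  have Pj := ex_minnP exP.
  case: Pj => -[|j] /asboolP Pj minj.
    by move: Pj; rewrite mul0r scale0r addr0 => /(Zout _ Zz).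
  have jN : (j < N)%N.
    by apply: minj; apply/asboolP; rewrite mulrC tN; exact: Zin.
  exists j => //=; split.
    split.
      have nPj : ~ P j by move=> /minj; rewrite ltnn.
      by move=> Oz; apply: nPj; apply/asboolP; rewrite addrAC -addrA.
    move: Pj; congr Omega; rewrite -natr1.
    by apply/rowP => i; rewrite !mxE; ring.
  rewrite /= -mulrA; apply: (le_trans (enorm_le_norm _)); rewrite ler_wpM2l//.
  have [w wd ->] := Zw _ Zz.
  rewrite (le_trans (ler_normD _ _))// (normrZ (r * eps)%R) (normrZ (j%:R * t)%R).
  rewrite (gtr0_norm re0) ger0_norm; last by rewrite mulr_ge0// ltW.
  have jr : (j%:R * t <= r)%R.
    by rewrite -tN mulrC ler_pM2l// ler_nat ltnW.
  have h3 : (`|w - d| <= delta + `|d|)%R by rewrite (le_trans (ler_normB _ _))// lerD2r ltW.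
  have h4 : (j%:R * t * `|d| <= r * `|d|)%R by rewrite ler_wpM2r.
  have h5 : (r * eps * `|w - d| <= r * delta)%R.
    rewrite -mulrA ler_pM2l// (le_trans _ (ltW ed))// ler_pM2l//.
  lra.
apply: (@le_trans _ _ (mu (\big[setU/set0]_(j < N) A_ j))).
  apply: le_measure => //; rewrite inE//.
  by apply: bigsetU_measurable => j _; exact: mA_.
apply: (le_trans (Boole_inequality mu (fun j _ => mA_ j))).
rewrite (eq_bigr (fun=> mu A)); last first.
  by move=> j _; rewrite [RHS](mu_translate ((j%:R * t) *: d)%R).
by rewrite sumr_const card_ord -[X in X <= _]mule_natl.
Qed.

End gain.

Section boundary.
Context {R : realType} {n : nat}.
Local Notation mu := (@lebesgue_rV R n).
Implicit Types (x y z p q d w : 'rV[R]_n) (Omega A : set 'rV[R]_n).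
Local Open Scope ereal_scope.

(** Layer-cake minorant: near 0 the kernel is at least [|z| ^ (1 - n)], and
    [dyadic_layers] bounds this power below by a combination of indicators of balls. *)
Lemma riesz_kernel_layers alpha (c : R) K z : (2 <= n)%N -> (alpha <= 1)%R ->
  (0 < c <= 1)%R -> z != 0%R ->
  (\sum_(k < K) c ^- n.-1 * (2^-1 * (2 ^+ n.-1) ^+ k) *
     \1_[set z | (enorm z <= c / 2 ^+ k)%R] z)%:E <= riesz_kernel alpha z.
Proof.
move=> n2 a1 /andP[c0 c1] z0.
have n10 : (0 < n.-1)%N by rewrite -ltnS prednK// (leq_trans _ n2).
have ez : (0 < enorm z)%R by rewrite enorm_gt0.
have E (k : nat) : (z \in [set z : 'rV[R]_n | (enorm z <= c / 2 ^+ k)%R]) =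
    (enorm z / c * 2 ^+ k <= 1)%R.
  rewrite mulrAC ler_pdivrMr// mul1r.
  have h : (0 < 2 ^+ k :> R)%R by rewrite exprn_gt0.
  by apply/idP/idP; rewrite inE/= ler_pdivlMr.
rewrite lee_fin.
have [zc|zc] := leP (enorm z) c; last first.
  rewrite big1 ?powR_ge0// => k _; rewrite indicE E.
  rewrite leNgt (_ : (1 < _)%R) ?mulr0//.
  have h : (1 <= 2 ^+ k :> R)%R by rewrite exprn_ege1// ler1n.
  have h' : (1 < enorm z / c)%R by rewrite ltr_pdivlMr// mul1r.
  by nra.
apply: (@le_trans _ _ (enorm z ^- n.-1)%R).
  have := @dyadic_layers R n.-1 K (enorm z / c) n10.
  rewrite divr_gt0// => /(_ isT).
  rewrite -(@ler_pM2l _ (c ^- n.-1)%R) ?invr_gt0 ?exprn_gt0//.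
  rewrite expr_div_n invf_div mulrA mulVf ?mul1r ?gt_eqF ?exprn_gt0//.
  rewrite mulr_sumr => h; apply: le_trans h.
  by apply: ler_sum => k _; rewrite indicE E -mulrA.
rewrite -powR_invn ?enorm_ge0//; apply: ger_powR.
  by rewrite ez (le_trans zc).
have -> : (n%:R = n.-1%:R + 1 :> R)%R by rewrite natr1 prednK// (leq_trans _ n2).
lra.
Qed.

(** Each of the [K] dyadic scales between [t = r0 / 2 ^ K] and [r0] contributes a
    fixed multiple of [t]: the entered measure is of order [t r ^ (n - 1)] and the
    corresponding layer has height of order [r ^ (1 - n)]. *)
Lemma gain_bound alpha Omega D p d (delta eps r0 : R) K :
  (2 <= n)%N -> (alpha <= 1)%R ->
  compact Omega -> segment_closed Omega -> Omega p -> ~ interior Omega p ->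
  (0 < delta)%R -> (forall w, `|w| < delta -> Omega (p + d + w))%R ->
  (0 < eps <= 1)%R -> (eps * (delta + `|d|) < delta)%R ->
  (0 < r0 <= 1)%R -> (n%:R * (delta + `|d|) * r0 <= 1)%R ->
  (n%:R * (delta + `|d|) * r0 < D)%R ->
  (K%:R * (2^-1 * (n%:R * (delta + `|d|) * r0) ^- n.-1 *
     (2 * (r0 * (eps * delta))) ^+ n / 2 ^+ K))%:E <=
  \int[mu]_(z in [set z | (enorm z < D)%R /\ entered Omega p d (r0 / 2 ^+ K) z])
      riesz_kernel alpha z.
Proof.
move=> n2 a1 kO cO Op nip d0 dO eps01 epsd /andP[r00 r01] c1 cD.
have clO := compact_closed_rV _ kO.
have mO := closed_measurable_rV _ clO.
have n0 : (0 < n)%N by rewrite (leq_trans _ n2).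
set c := (n%:R * (delta + `|d|) * r0)%R in c1 cD *.
have c0 : (0 < c)%R by rewrite !mulr_gt0 ?ltr0n// ltr_wpDr.
set t := (r0 / 2 ^+ K)%R.
set A := [set z | _].
have mB := @measurable_enorm_lt R n D.
have mA : measurable A by apply: measurableI => //; exact: measurable_entered.
pose B k := [set z : 'rV[R]_n | (enorm z <= c / 2 ^+ k)%R].
have mBk k : measurable (B k).
  rewrite (_ : B k = [set z | enorm z \in `]-oo, (c / 2 ^+ k)%R] ]);
    first exact: measurable_enorm_itv.
  by apply/seteqP; split => z /=; rewrite in_itv.
pose a (k : nat) : R := (c ^- n.-1 * (2^-1 * (2 ^+ n.-1) ^+ k))%R.
have a0 k : (0 <= a k)%R.
  by rewrite !mulr_ge0 ?invr_ge0 ?exprn_ge0// ltW.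
have mI k : measurable_fun A (fun z => (a k * \1_(B k) z)%:E).
  by apply/measurable_EFinP; apply: measurable_funM.
apply: (@le_trans _ _ (\int[mu]_(z in A) (\sum_(k < K) (a k * \1_(B k) z)%:E))); last first.
  apply: ge0_le_integral => //.
  - by move=> z _; apply: sume_ge0 => k _; rewrite lee_fin mulr_ge0.
  - by apply: emeasurable_sum => k; exact: mI.
  - exact: measurable_riesz_kernel.
  - move=> z [_ [nOz _]]; rewrite sumEFin; apply: riesz_kernel_layers => //.
      by rewrite c0.
    by apply: contra_not_neq nOz => ->; rewrite addr0.
rewrite ge0_integral_sum//; last first.
  by move=> k z _; rewrite lee_fin mulr_ge0.
rewrite mulr_natl EFin_natmul.
set g := (X in X *+ K).
rewrite (_ : g *+ K = \sum_(k < K) g); last by rewrite sumr_const card_ord.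
apply: lee_sum => k _.
under eq_integral do rewrite EFinM.
rewrite ge0_integralZl//; last 2 first.
- by apply/measurable_EFinP; exact: measurable_indic.
- by rewrite lee_fin.
rewrite integral_indic//.
have kK : (k <= K)%N by rewrite ltnW.
pose N := (2 ^ (K - k))%N.
have N0 : (0 < N)%N by rewrite expn_gt0.
have tw (j : nat) : (0 < 2 ^+ j :> R)%R by rewrite exprn_gt0.
have rk1 : (0 < r0 / 2 ^+ k <= 1)%R.
  by rewrite divr_gt0//= ler_pdivrMr// mul1r (le_trans r01)// exprn_ege1// ler1n.
have NE : (N%:R = 2 ^+ K / 2 ^+ k :> R)%R.
  by rewrite /N natrX exprB// unitfE gt_eqF.
have tE : (r0 / 2 ^+ k / N%:R = t)%R.
  by rewrite NE /t invf_div mulrA divfK// gt_eqF.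
have := entered_measure _ _ _ _ _ _ _ kO cO Op nip d0 dO eps01 epsd rk1 N0.
rewrite tE => h.
have BA : B k `&` A = entered Omega p d t `&`
    [set z | (enorm z <= n%:R * (delta + `|d|) * (r0 / 2 ^+ k))%R].
  rewrite mulrA -/c; apply/seteqP; split => z /=; first by case=> ? [].
  case=> ez ck; split => //; split => //; rewrite /= (le_lt_trans ck)//.
  rewrite (le_lt_trans _ cD)// ler_pdivrMr// ler_peMr ?(ltW c0)//.
  by rewrite exprn_ege1// ler1n.
rewrite BA.
have N0R : (0 < N%:R :> R)%R by rewrite ltr0n.
apply: (@le_trans _ _ ((a k / N%:R)%:E * (N%:R%:E * mu (entered Omega p d t `&`
    [set z | (enorm z <= n%:R * (delta + `|d|) * (r0 / 2 ^+ k))%R])))); last first.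
  by rewrite muleA -EFinM divfK ?gt_eqF.
apply: (@le_trans _ _ ((a k / N%:R)%:E *
    ((2 * (r0 / 2 ^+ k * (eps * delta))) ^+ n)%:E)); last first.
  by rewrite lee_wpmul2l// lee_fin divr_ge0// ltW.
rewrite -EFinM lee_fin /a NE.
rewrite (_ : 2 * (r0 / 2 ^+ k * (eps * delta)) = 2 * (r0 * (eps * delta)) / 2 ^+ k)%R; last first.
  by field; rewrite gt_eqF.
rewrite expr_div_n exprAC -[X in (2 ^+ k) ^- X](prednK n0) exprS.
have cn : (0 < c ^+ n.-1)%R by rewrite exprn_gt0.
have tkn : (0 < (2 ^+ k) ^+ n.-1 :> R)%R by rewrite exprn_gt0.
rewrite le_eqVlt; apply/orP; left; apply/eqP.
move: (tw k) (tw K) cn tkn; move: (2 ^+ k)%R (2 ^+ K)%R => x y x0 y0 cn xn.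
by field; rewrite !gt_eqF.
Qed.

End boundary.

Section existence.
Context {R : realType} {n : nat}.
Local Notation mu := (@lebesgue_rV R n).
Implicit Types (x y z p q d w : 'rV[R]_n) (Omega A : set 'rV[R]_n).
Local Open Scope ereal_scope.

(** Move from the boundary point [p] towards an interior point by [t = r0 / 2 ^ K].
    The loss is [O(t)] and the gain is at least [K t] times a positive constant, so
    the gain prevails for large [K]. Finiteness of the deficit at [p] allows the two to
    be compared. *)
Lemma deficit_boundary alpha Omega D p q : (2 <= n)%N -> (alpha <= 1)%R ->
  compact Omega -> segment_closed Omega -> (0 < D)%R ->
  Omega p -> ~ interior Omega p -> interior Omega q ->
  deficit alpha Omega D p < +oo ->
  exists2 x, Omega x & deficit alpha Omega D x < deficit alpha Omega D p.
Proof.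
move=> n2 a1 kO cO D0 Op nip iq pfin.
have clO := compact_closed_rV _ kO.
have mO := closed_measurable_rV _ clO.
have n0 : (0 < n)%N by rewrite (leq_trans _ n2).
pose d := (q - p)%R.
have [delta delta0 dO] : exists2 delta : R, (0 < delta)%R &
    forall w, (`|w| < delta)%R -> Omega (p + d + w)%R.
  have /interior_ballP[e e0 eO] := iq.
  by exists e => // w we; rewrite /d subrKC; exact: eO.
pose l := (delta + `|d|)%R.
have l0 : (0 < l)%R by rewrite ltr_wpDr.
pose eps := (delta / (2 * l))%R.
have epsl : (eps * l = delta / 2)%R by rewrite /eps; field; rewrite gt_eqF.
have eps0 : (0 < eps)%R by rewrite divr_gt0// mulr_gt0.
have eps1 : (0 < eps <= 1)%R.
  rewrite eps0 /eps ler_pdivrMr ?mulr_gt0// mul1r.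
  have := normr_ge0 d; rewrite /l; lra.
have epsd : (eps * l < delta)%R by rewrite epsl; lra.
pose L := (n%:R * l)%R.
have L0 : (0 < L)%R by rewrite mulr_gt0// ltr0n.
pose r0 := Num.min 1%R (Num.min (L^-1) (D / 2 / L))%R.
have r00 : (0 < r0)%R by rewrite !lt_min ltr01 invr_gt0 L0 !divr_gt0.
have r01 : (0 < r0 <= 1)%R by rewrite r00 ge_min lexx.
have Lr1 : (L * r0 <= 1)%R.
  by rewrite mulrC -ler_pdivlMr// div1r !ge_min lexx orbT.
have LrD : (L * r0 < D)%R.
  apply: (@le_lt_trans _ _ (D / 2)%R); last by lra.
  by rewrite mulrC -ler_pdivlMr// !ge_min lexx !orbT.
pose gamma := (2^-1 * (L * r0) ^- n.-1 * (2 * (r0 * (eps * delta))) ^+ n)%R.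
have gamma0 : (0 < gamma)%R.
  have h : (0 < 2 * (r0 * (eps * delta)))%R.
    by apply: mulr_gt0 => //; apply: mulr_gt0 => //; exact: mulr_gt0.
  apply: mulr_gt0; last exact: exprn_gt0.
  by apply: mulr_gt0 => //; rewrite invr_gt0; apply: exprn_gt0; exact: mulr_gt0.
pose lambda := (delta `^ (alpha - n%:R) * (n%:R * r0 * fine (mu Omega)))%R.
have lambda0 : (0 <= lambda)%R.
  by rewrite mulr_ge0 ?powR_ge0// mulr_ge0 ?fine_ge0// mulr_ge0 ?ler0n// ltW.
(* Both the gain and the loss are of the form constant / 2 ^ K, up to the factor
   [K] in the gain. *)
have [K KP] : exists K : nat, (lambda < K%:R * gamma)%R.
  exists (Num.bound (lambda / gamma)).
  by rewrite -ltr_pdivrMr// archi_boundP// divr_ge0// ltW.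
have K0 : (0 < K)%N.
  rewrite lt0n; apply: contraTneq KP => ->.
  by rewrite mul0r -leNgt.
pose t := (r0 / 2 ^+ K)%R.
have K2 : (1 < 2 ^+ K :> R)%R by rewrite exprn_egt1 ?ltr1n// -lt0n.
have t1 : (0 <= t < 1)%R.
  rewrite divr_ge0 ?(ltW r00) ?(ltW (lt_trans ltr01 K2))//=.
  rewrite ltr_pdivrMr ?(lt_trans ltr01 K2)// mul1r (le_lt_trans _ K2)//.
  by case/andP: r01.
have gain := gain_bound alpha Omega D p d delta eps r0 K n2 a1 kO cO Op nip delta0 dO
  eps1 epsd r01 Lr1 LrD.
have loss := loss_bound alpha Omega D p d delta t a1 n2 kO cO Op delta0 dO t1.
exists (p + t *: d)%R.
  have -> : (p + t *: d = t *: (p + d + 0) + (1 - t) *: p)%R.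
    by apply/rowP => i; rewrite !mxE; ring.
  apply: cO => //; first by apply: dO; rewrite normr0.
  by case/andP: t1 => -> /ltW.
have := deficit_exchange alpha Omega D p (t *: d)%R mO.
move: gain loss; rewrite /entered -/t.
set G := \int[mu]_(z in _) _; set Ls := \int[mu]_(z in _) _ => gain loss E.
have LG : Ls < G.
  apply: le_lt_trans loss (lt_le_trans _ gain); rewrite lte_fin.
  have -> : (delta `^ (alpha - n%:R) * (n%:R * t * fine (mu Omega)) = lambda / 2 ^+ K)%R.
    rewrite /lambda /t; move: (lt_trans ltr01 K2) (fine _) (delta `^ _)%R => K2' M w.
    by field; rewrite gt_eqF.
  by rewrite -/l -/L -/gamma mulrA ltr_pM2r// invr_gt0 (lt_trans ltr01 K2).
have Lsf : Ls \is a fin_num.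
  rewrite ge0_fin_numE; first exact: (lt_le_trans LG (leey _)).
  by apply: integral_ge0 => z _; exact: riesz_kernel_ge0.
have pf : deficit alpha Omega D p \is a fin_num by rewrite ge0_fin_numE ?deficit_ge0.
rewrite ltNge; apply/negP => h.
have : deficit alpha Omega D p + G <= deficit alpha Omega D p + Ls.
  by rewrite -E leeD2r.
by rewrite leeD2lE// leNgt LG.
Qed.

(** Fatou: the complement of [Omega] is open, so a point [z] with [x + z] outside
    [Omega] has [x_ k + z] outside for large [k]. *)
Lemma deficit_lsc alpha Omega D (x_ : nat -> 'rV[R]_n) x (a : R) : closed Omega ->
  x_ @ \oo --> x ->
  (forall k, deficit alpha Omega D (x_ k) <= (a + k.+1%:R^-1)%:E) ->
  deficit alpha Omega D x <= a%:E.
Proof.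
move=> cO xx le_a.
have mO := closed_measurable_rV _ cO.
pose f k := deficit_kernel alpha Omega D (x_ k).
have defE y : deficit alpha Omega D y = \int[mu]_z deficit_kernel alpha Omega D y z.
  by rewrite /deficit integral_mkcond.
have mf k : measurable_fun setT (f k) by exact: measurable_deficit_kernel.
have f0 k z : 0 <= f k z by exact: deficit_kernel_ge0.
have low z : deficit_kernel alpha Omega D x z <= limn_einf (f ^~ z).
  have [N fN] : exists N, forall k, (N <= k)%N -> deficit_kernel alpha Omega D x z <= f k z.
    rewrite /f /deficit_kernel /patch; case: ifPn => [|_]; last first.
      by exists 0%N => k _; exact: (f0 k z).
    rewrite inE/= => -[zD Oz].
    have nO : nbhs (x + z)%R (~` Omega).
      by apply: open_nbhs_nbhs; split => //; exact: closed_openC.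
    have cz : (fun k => x_ k + z)%R @ \oo --> (x + z)%R by apply: cvgD => //; exact: cvg_cst.
    have [N _ NP] := cz _ nO.
    by exists N => k Nk; rewrite mem_set//; split => //; exact: (NP k Nk).
  rewrite limn_einf_lim; apply: lime_ge; first exact: is_cvg_einfs.
  exists N => // k /= Nk; apply/ereal_infP => _ [j /= kj <-].
  by apply: fN; exact: leq_trans kj.
rewrite defE; apply: (@le_trans _ _ (\int[mu]_z limn_einf (f ^~ z))).
  apply: ge0_le_integral => //.
  - by move=> z _; exact: deficit_kernel_ge0.
  - exact: measurable_deficit_kernel.
  - apply: (@measurableT_comp _ _ _ _ _ _ (@oppe R)); first exact: oppe_measurable.
    apply: (@measurable_fun_limn_esup _ _ _ _ (fun k z => - f k z)) => k.
    by apply: (@measurableT_comp _ _ _ _ _ _ (@oppe R)); first exact: oppe_measurable.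
apply: (le_trans (fatou _ _ _ _)) => //.
rewrite limn_einf_lim.
have cva : (fun k => (a + k.+1%:R^-1)%:E) @ \oo --> a%:E.
  apply: cvg_EFin; first by apply: nearW.
  rewrite -[X in _ --> X]addr0; apply: cvgD; first exact: cvg_cst.
  exact: cvg_harmonic.
rewrite -(cvg_lim _ cva)//; apply: lee_lim.
- exact: is_cvg_einfs.
- exact: (cvgP _ cva).
apply: nearW => k; apply: le_trans (le_a k).
rewrite defE; apply: ereal_inf_lbound; exists k => //=.
Qed.

End existence.

(** * Points outside the body *)

Section projection.
Context {R : realType} {n : nat}.
Local Notation mu := (@lebesgue_rV R n).
Implicit Types (x y z p q a b : 'rV[R]_n) (Omega : set 'rV[R]_n).

Lemma enorm_sqrB a b t : enorm (a - t *: b) ^+ 2 =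
  enorm a ^+ 2 - 2 * t * (\sum_(i < n) a ord0 i * b ord0 i) + t ^+ 2 * enorm b ^+ 2.
Proof.
rewrite !enorm_sqr !mulr_sumr -sumrB -big_split/=.
by apply: eq_bigr => i _; rewrite !mxE; ring.
Qed.

Lemma enorm_sqr_le x y : (enorm x <= enorm y) = (enorm x ^+ 2 <= enorm y ^+ 2).
Proof. by rewrite ler_pXn2r// nnegrE enorm_ge0. Qed.

(** The nearest point [p] of [Omega]: for [z] in [Omega] the angle at [p] between [y]
    and [z] is not acute, so [y] is at least as far from [z] as [p] is. *)
Lemma projection Omega y : compact Omega -> segment_closed Omega ->
  Omega !=set0 -> ~ Omega y ->
  exists p, [/\ Omega p, ~ interior Omega p &
    forall z, Omega z -> enorm (p - z) <= enorm (y - z)].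
Proof.
move=> kO cO O0 Oy.
have cf : continuous (fun p : 'rV[R]_n => enorm (y - p)).
  move=> p; apply: (@continuous_comp _ _ _ (fun p => y - p) (@enorm R n)).
    apply: (@continuousB _ _ _ (fun=> y) id); first exact: cst_continuous.
    exact: (fun U => id).
  exact: enorm_continuous.
have [p] := EVT_min_rV O0 kO (continuous_subspaceT cf).
rewrite inE => Op pmin.
have ya : y - p != 0.
  by rewrite subr_eq0; apply: contra_not_neq Oy => ->.
have ea : 0 < enorm (y - p) by rewrite enorm_gt0.
exists p; split=> //.
  move=> /interior_ballP[d d0 dO].
  have nya : 0 < `|y - p| by rewrite normr_gt0.
  pose t := Num.min (1 / 2) (d / 2 / `|y - p|).
  have t0 : 0 < t by rewrite lt_min !divr_gt0.
  have t1 : t <= 1 / 2 by rewrite ge_min lexx.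
  have Ot : Omega (p + t *: (y - p)).
    apply: dO; rewrite normrZ gtr0_norm//.
    apply: (@le_lt_trans _ _ (d / 2)); last by lra.
    by rewrite -ler_pdivlMr// ge_min lexx orbT.
  have := pmin _ (mem_set Ot).
  have -> : y - (p + t *: (y - p)) = (1 - t) *: (y - p).
    by rewrite scalerBl scale1r opprD addrA.
  rewrite enormZ ger0_norm; last by lra.
  nra.
move=> z Oz.
have dot0 : \sum_(i < n) (y - p) ord0 i * (z - p) ord0 i <= 0.
  rewrite leNgt; apply/negP => dot_gt0.
  set dt := \sum_(i < n) _ in dot_gt0.
  pose B := enorm (z - p) ^+ 2 + 1.
  have B0 : 0 < B by rewrite ltr_wpDl// sqr_ge0.
  pose t := Num.min 1 (dt / B).
  have t0 : 0 < t by rewrite lt_min ltr01 divr_gt0.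
  have t1 : t <= 1 by rewrite ge_min lexx.
  have tB : t * B <= dt by rewrite -ler_pdivlMr// ge_min lexx orbT.
  have Ot : Omega (t *: z + (1 - t) *: p) by apply: cO => //; rewrite ltW.
  have := pmin _ (mem_set Ot).
  have -> : y - (t *: z + (1 - t) *: p) = (y - p) - t *: (z - p).
    by apply/rowP => i; rewrite !mxE; ring.
  rewrite enorm_sqr_le (enorm_sqrB (y - p) (z - p) t) -/dt.
  have tBE : t * B = t * enorm (z - p) ^+ 2 + t by rewrite /B; ring.
  nra.
rewrite enorm_sqr_le.
have -> : y - z = (y - p) - 1 *: (z - p).
  by apply/rowP => i; rewrite !mxE; ring.
rewrite (enorm_sqrB (y - p) (z - p) 1) enormB.
have := sqr_ge0 (enorm (y - p)); nra.
Qed.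

(** The comparison of the kernels fails at [z = p], where the totalized power takes
    the value 0, but this is a null set. *)
Lemma riesz_projection alpha Omega y p : (0 < n)%N -> alpha < n%:R ->
  closed Omega -> Omega p ->
  (forall z, Omega z -> enorm (p - z) <= enorm (y - z)) ->
  (riesz_integral alpha Omega y <= riesz_integral alpha Omega p)%E.
Proof.
move=> n0 an cO Op le_pz.
have mO := closed_measurable_rV _ cO.
have mk x : measurable_fun Omega (fun z : 'rV[R]_n => (enorm (x - z) `^ (alpha - n%:R))%:E).
  have H := measurableT_comp (@measurable_riesz_kernel R n alpha setT)
    (@measurable_affine_rV R n (-1) x).
  apply: measurable_funTS; move: H; congr (measurable_fun _ _).
  by apply/funext => z /=; rewrite /riesz_kernel scaleN1r addrC.
rewrite /riesz_integral; apply: ae_ge0_le_integral => //.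
- by move=> z _; rewrite lee_fin powR_ge0.
- by move=> z _; rewrite lee_fin powR_ge0.
exists [set p]; split.
- by apply: closed_measurable_rV; exact: closed_set1_rV.
- exact: mu_set1.
move=> z /=; apply: contra_notP => zp Oz.
rewrite lee_fin; apply: powR_nincr.
- by rewrite subr_le0 ltW.
- by rewrite enorm_gt0 subr_eq0; apply/eqP => h; exact: zp.
- exact: le_pz.
Qed.

End projection.

(** * Existence and uniqueness of the minimiser *)

Section minimiser.
Context {R : realType} {n : nat}.
Implicit Types (x y z p q a b : 'rV[R]_n) (Omega : set 'rV[R]_n).
Local Open Scope ereal_scope.

Lemma diameter_bound Omega : compact Omega -> exists2 D : R, (0 < D)%R &
  forall p q, Omega p -> Omega q -> (enorm (q - p) < D)%R.
Proof.
move=> /compact_bounded[M [_ MO]].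
have M0 : (0 <= `|M| + 1)%R by rewrite addr_ge0.
have MO' p : Omega p -> (`|p| <= `|M| + 1)%R.
  by apply: MO; rewrite (le_lt_trans (ler_norm _))// ltrDl.
exists (n%:R * (2 * (`|M| + 1)) + 1)%R; first by rewrite ltr_wpDl// !mulr_ge0.
move=> p q Op Oq; rewrite (le_lt_trans (enorm_le_norm _))//.
rewrite ltr_pwDr// ler_wpM2l// (le_trans (ler_normB _ _))//.
by have := MO' _ Op; have := MO' _ Oq; lra.
Qed.

Lemma deficit_minimiser alpha Omega D q : (2 <= n)%N -> (alpha <= 1)%R ->
  compact Omega -> segment_closed Omega -> (0 < D)%R -> interior Omega q ->
  deficit alpha Omega D q < +oo ->
  exists2 x, interior Omega x &
    forall y, Omega y -> deficit alpha Omega D x <= deficit alpha Omega D y.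
Proof.
move=> n2 a1 kO cO D0 iq qfin.
have clO := compact_closed_rV _ kO.
have Oq := interior_subset iq.
have [x Ox xmin] := compact_lsc_min Omega (deficit alpha Omega D) kO
  (@deficit_ge0 _ _ alpha Omega D) (ex_intro2 _ _ q Oq qfin)
  (fun (x_ : nat -> _) x (a : R) _ => deficit_lsc alpha Omega D x_ x a clO).
exists x => //; apply: contrapT => nix.
have xfin : deficit alpha Omega D x < +oo by exact: le_lt_trans (xmin _ Oq) qfin.
have [y Oy] := deficit_boundary _ _ _ _ _ n2 a1 kO cO D0 Ox nix iq xfin.
by rewrite ltNge xmin.
Qed.

Lemma deficit_minimiser_unique alpha Omega D x y : (2 <= n)%N -> (alpha <= 1)%R ->
  compact Omega -> segment_closed Omega ->
  (forall p q, Omega p -> Omega q -> enorm (q - p) < D)%R ->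
  interior Omega x -> interior Omega y ->
  deficit alpha Omega D x \is a fin_num ->
  (forall z, interior Omega z -> deficit alpha Omega D x <= deficit alpha Omega D z) ->
  (forall z, interior Omega z -> deficit alpha Omega D y <= deficit alpha Omega D z) ->
  deficit alpha Omega D (2^-1 *: (x + y))%R < +oo ->
  x = y.
Proof.
move=> n2 a1 kO cO OD ix iy xfin xmin ymin mfin; apply: contrapT => /eqP xy.
have im : interior Omega (2^-1 *: (x + y))%R by exact: interior_midpoint.
have := deficit_strict _ _ _ _ _ n2 a1 kO cO OD ix iy xy mfin.
have E : deficit alpha Omega D y = deficit alpha Omega D x.
  by apply/eqP; rewrite eq_le xmin// ymin.
rewrite E; have := xmin _ im; rewrite -(fineK xfin).
have : deficit alpha Omega D (2^-1 *: (x + y))%R \is a fin_num.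
  by rewrite ge0_fin_numE// deficit_ge0.
move=> /fineK <-; rewrite -EFinM -EFinD lee_fin lte_fin; lra.
Qed.

End minimiser.

Theorem theorem3p12 (R : realType) (m : nat) (hm : (2 <= m)%N)
    (alpha : R) (halpha : alpha <= 1) (Omega : set 'rV[R]_m)
    (hOmega : convex_body Omega) (hC1 : piecewise_C1_boundary Omega) :
  (exists! x : 'rV[R]_m, is_center alpha Omega x) /\
  (forall x : 'rV[R]_m, is_center alpha Omega x -> interior Omega x).
Proof.
have [neO [kO OE] vO] := hOmega.
have cO := convex_set_segment _ vO.
have m0 : (0 < m)%N by rewrite (leq_trans _ hm).
have clO := compact_closed_rV _ kO.
have [q iq] : interior Omega !=set0.
  apply/set0P/eqP => i0; case: neO => x.
  by rewrite OE i0 closure0.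
have [D D0 OD] := diameter_bound _ kO.
have am : alpha < m%:R.
  by rewrite (le_lt_trans halpha)// ltr1n.
pose F := deficit alpha Omega D.
have [a0|a0] := leP alpha 0.
- have [c V] : exists c : R, forall x, interior Omega x -> F x \is a fin_num /\
      potential alpha Omega x = (c%:E - F x)%E.
    exists (sphere_area R m * powR_prim alpha D) => x ix.
    apply: deficit_interior => // y Oy.
    by apply: OD => //; exact: interior_subset.
  have leV x y : interior Omega x -> interior Omega y ->
      (potential alpha Omega y <= potential alpha Omega x)%E = (F x <= F y)%E.
    move=> ix iy; have [fx ->] := V x ix; have [fy ->] := V y iy.
    by rewrite leeD2lE// leeN2.
  have centerP x : is_center alpha Omega x <->
      interior Omega x /\ forall y, interior Omega y -> (F x <= F y)%E.
    rewrite /is_center a0; split=> -[ix h]; (split; first exact: ix) => y iy.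
      by rewrite -(leV x y ix iy); exact: h.
    by rewrite (leV x y ix iy); exact: h.
  have Flty x : interior Omega x -> (F x < +oo)%E.
    by move=> ix; rewrite -ge0_fin_numE ?deficit_ge0//; exact: (V x ix).1.
  have [x ix xmin] := deficit_minimiser _ _ _ _ hm halpha kO cO D0 iq (Flty q iq).
  split; last by move=> y /centerP[].
  exists x; split.
    apply/centerP; split; first exact: ix.
    by move=> y /interior_subset; exact: xmin.
  move=> y /centerP[iy ymin].
  apply: (deficit_minimiser_unique _ _ _ _ _ hm halpha kO cO OD ix iy).
  + exact: (V x ix).1.
  + by move=> z /interior_subset; exact: xmin.
  + exact: ymin.
  + by apply: Flty; exact: interior_midpoint.
have V x : Omega x -> F x \is a fin_num /\ exists2 c : R,
    c%:E = (\int[@lebesgue_rV R m]_(z in [set z | (enorm z < D)%R]) riesz_kernel alpha z)%E &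
    potential alpha Omega x = (c%:E - F x)%E.
  by move=> Ox; apply: deficit_pos => // y Oy; exact: OD.
have potE x : potential alpha Omega x = riesz_integral alpha Omega x.
  by rewrite /potential leNgt a0.
have leV x y : Omega x -> Omega y ->
    (potential alpha Omega y <= potential alpha Omega x)%E = (F x <= F y)%E.
  move=> Ox Oy; have [fx [c cE ->]] := V x Ox; have [fy [c' c'E ->]] := V y Oy.
  have -> : c' = c by apply: EFin_inj; rewrite cE c'E.
  by rewrite leeD2lE// leeN2.
have Flty x : Omega x -> (F x < +oo)%E.
  by move=> Ox; rewrite -ge0_fin_numE ?deficit_ge0//; exact: (V x Ox).1.
have Oq := interior_subset iq.
have [x ix xmin] := deficit_minimiser _ _ _ _ hm halpha kO cO D0 iq (Flty q Oq).
have Ox := interior_subset ix.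
have notmin p : Omega p -> ~ interior Omega p ->
    exists2 y, Omega y & (potential alpha Omega p < potential alpha Omega y)%E.
  move=> Op nip.
  have [y Oy yp] := deficit_boundary _ _ _ _ _ hm halpha kO cO D0 Op nip iq (Flty p Op).
  exists y; first exact: Oy.
  by rewrite ltNge (leV p y Op Oy) -ltNge.
(* The nearest point of the body does at least as well as [y], and it is a
   boundary point. *)
have outside y : ~ Omega y -> exists2 z, Omega z &
    (potential alpha Omega y < potential alpha Omega z)%E.
  move=> nOy; have [p [Op nip pz]] := projection _ _ kO cO neO nOy.
  have [z Oz zp] := notmin p Op nip; exists z; first exact: Oz.
  by apply: le_lt_trans zp; rewrite !potE; exact: riesz_projection pz.
have interior_center y : is_center alpha Omega y -> interior Omega y.
  rewrite /is_center leNgt a0 => -[_ ymax]; apply: contrapT => niy.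
  have [z _] : exists2 z, Omega z & (potential alpha Omega y < potential alpha Omega z)%E.
    by have [Oy|nOy] := pselect (Omega y); [exact: notmin|exact: outside].
  by rewrite ltNge ymax.
split; last exact: interior_center.
exists x; split.
  rewrite /is_center leNgt a0; split; first exact: am.
  move=> y.
  have [Oy|nOy] := pselect (Omega y); first by rewrite (leV x y Ox Oy) xmin.
  have [z Oz yz] := outside y nOy.
  by apply: (le_trans (ltW yz)); rewrite (leV x z Ox Oz); exact: xmin.
move=> y cy; have iy := interior_center y cy; have Oy := interior_subset iy.
move: cy; rewrite /is_center leNgt a0 => -[_ ymax].
apply: (deficit_minimiser_unique _ _ _ _ _ hm halpha kO cO OD ix iy).
- exact: (V x Ox).1.
- by move=> z /interior_subset; exact: xmin.
- by move=> z /interior_subset Oz; rewrite -(leV y z Oy Oz).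
- by apply: Flty; apply: interior_subset; exact: interior_midpoint.
Qed.
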